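(* Let $n\geq 4$. (i) $\Delta_D(S_n)$ is perfect if and only if $n\leq 5$. (ii) $\Delta_D(A_n)$ is perfect if and only if $n\leq 7$.
   Context: $S_n$ and $A_n$ are the symmetric and alternating groups. The deep commuting graph $\Delta_D(G)$ has vertex set $G$, distinct vertices adjacent iff their preimages commute in a Schur cover $\tilde G$ of $G$ (a central extension $\{e\}\to M(G)\to\tilde G\to G\to\{e\}$ with kernel contained in $Z(\tilde G)\cap[\tilde G,\tilde G]$, of maximal order; $M(G)$ the Schur multiplier). A graph is perfect if every induced subgraph has clique number equal to its chromatic number. *)

(* Defs.v *)
From mathcomp Require Import all_boot all_fingroup all_solvable.
From mathcomp Require Import alt.
Set Implicit Arguments. Unset Strict Implicit. Unset Printing Implicit Defensive.
Local Open Scope group_scope.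

Definition stem_extension (gT hT : finGroupType) (G : {set gT})
    (H : {group hT}) (f : {morphism H >-> gT}) : Prop :=
  f @* H = G /\ 'ker f \subset 'Z(H) :&: H^`(1).

Definition schur_cover (gT hT : finGroupType) (G : {set gT})
    (H : {group hT}) (f : {morphism H >-> gT}) : Prop :=
  stem_extension G f /\
  forall (kT : finGroupType) (K : {group kT}) (g : {morphism K >-> gT}),
    stem_extension G g -> #|K| <= #|H|.

Definition deep_adj (gT hT : finGroupType) (H : {group hT})
    (f : {morphism H >-> gT}) : rel gT :=
  fun x y => [forall h1 in H, forall h2 in H,
                (f h1 == x) && (f h2 == y) ==> (h1 * h2 == h2 * h1)].

Definition is_clique (T : finType) (adj : rel T) (C : {set T}) : bool :=
  [forall x in C, forall y in C, (x != y) ==> adj x y].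

Definition clique_number (T : finType) (adj : rel T) (S : {set T}) : nat :=
  \max_(C : {set T} | (C \subset S) && is_clique adj C) #|C|.

Definition colorable (T : finType) (adj : rel T) (S : {set T}) (k : nat) : bool :=
  [exists c : {ffun T -> 'I_(#|T|.+1)},
     [forall x in S, c x < k] &&
     [forall x in S, forall y in S,
       ((x != y) && adj x y) ==> (c x != c y)]].

Definition chromatic_number (T : finType) (adj : rel T) (S : {set T}) : nat :=
  \big[minn/#|T|]_(k < #|T|.+1 | colorable adj S k) k.

Definition perfect_graph (T : finType) (V : {set T}) (adj : rel T) : Prop :=
  forall S : {set T}, S \subset V ->
    clique_number adj S = chromatic_number adj S.

(* Main.v *)
(* If two elements generate a cyclic subgroup, then their lifts to a stem extension commute; for
   the groups that have to be shown perfect, the converse holds in a Schur cover.  All these groups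
   embed in A_7 (S_n with n <= 5 as even permutations of n + 2 points), so it is enough to know
   some central extension K of A_7 in which the lifts of two elements commute only if these
   generate a cyclic subgroup.  Such a K, related to the 6-fold cover of A_7, is generated by
   two pairs of a permutation and a 6 x 6 matrix over the field with 7 elements.  A Schur cover
   commutes at most as much as any central extension: the fibre product of both can be turned into
   a stem extension when G / G' is cyclic, and this stem extension cannot be larger than the
   Schur cover.  Thus the deep commuting graph embeds in the enhanced power graph of A_7, where
   the neighbours of v that have at least as many fixed points as v lie in a cyclic subgroup.
   So there is a perfect elimination ordering.

   For n >= 8, five 3-cycles on 8 points form a 5-hole in the graph of A_n: disjoint 3-cycles are
   adjacent because some even permutation squares one and centralises the other.  For
   n >= 6, if (1 2) and (3 4) are adjacent in the graph of S_n then it contains a pentagon of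
   transpositions, and otherwise a 7-hole of transpositions and 3-cycles. *)
Require Import Defs.
From mathcomp Require Import all_boot all_fingroup all_solvable all_algebra.
From mathcomp Require Import alt zify.
Set Implicit Arguments. Unset Strict Implicit. Unset Printing Implicit Defensive.
Import GRing.Theory.

(** * Graphs *)

Section Graphs.
Variable T : finType.
Implicit Types (S V C : {set T}) (adj : rel T).

Lemma bigmin_leq (I : eqType) (r : seq I) (P : pred I) (F : I -> nat) d i :
  i \in r -> P i -> \big[minn/d]_(j <- r | P j) F j <= F i.
Proof.
elim: r => // j r IHr; rewrite inE big_cons => /predU1P[<- -> | ir Pi].
  exact: geq_minl.
case: ifP => _; last exact: IHr.
exact: leq_trans (geq_minr _ _) (IHr ir Pi).
Qed.

Lemma chromatic_number_leq adj S k :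
  k <= #|T| -> colorable adj S k -> chromatic_number adj S <= k.
Proof.
move=> leT Sk; rewrite -ltnS in leT.
by apply: (@bigmin_leq _ _ _ _ _ (Ordinal leT)) => //; rewrite mem_index_enum.
Qed.

(** The first alternative accounts for the default value of the minimum. *)
Lemma chromatic_number_colorable adj S :
  chromatic_number adj S = #|T| \/ colorable adj S (chromatic_number adj S).
Proof.
rewrite /chromatic_number; elim/big_ind: _ => [|x y xP yP|k ?]; [by left| |by right].
by rewrite /minn; case: ifP.
Qed.

Lemma clique_numberP adj S C :
  C \subset S -> is_clique adj C -> #|C| <= clique_number adj S.
Proof. by move=> CS Ccl; apply: (bigmax_sup C) => //; rewrite CS Ccl. Qed.

Lemma clique_number_le_card adj S : clique_number adj S <= #|T|.
Proof. by apply/bigmax_leqP => C _; apply: max_card. Qed.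

Lemma card_ltn_ord n k : k <= n -> #|[set i : 'I_n | i < k]| = k.
Proof. by move=> lekn; rewrite cardsE -sum1_card (big_ord_narrow lekn) sum1_card card_ord. Qed.

Lemma clique_number_le_colorable adj S k :
  colorable adj S k -> clique_number adj S <= k.
Proof.
case/existsP=> c /andP[/forall_inP ck /forall_inP cP].
apply/bigmax_leqP => C /andP[/subsetP CS /forall_inP Ccl].
have cinj : {in C &, injective c}.
  move=> x y xC yC cxy; apply/eqP/negPn/negP => xy.
  have := implyP (forall_inP (cP x (CS x xC)) y (CS y yC)).
  by rewrite xy (implyP (forall_inP (Ccl x xC) y yC) xy) cxy eqxx => /(_ isT).
have [ltT|leT] := ltnP #|T| k; first exact: leq_trans (max_card _) (ltnW ltT).
rewrite -(card_in_imset cinj) -(card_ltn_ord (leqW leT)) subset_leq_card //.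
by apply/subsetP => _ /imsetP[x xC ->]; rewrite inE ck ?CS.
Qed.

Lemma perfect_graph_colorable adj V :
    (forall S, S \subset V -> colorable adj S (clique_number adj S)) ->
  perfect_graph V adj.
Proof.
move=> colV S SV; apply/eqP; rewrite eqn_leq; apply/andP; split.
  have [->|] := chromatic_number_colorable adj S; first exact: clique_number_le_card.
  exact: clique_number_le_colorable.
by apply: chromatic_number_leq (colV S SV); apply: clique_number_le_card.
Qed.

(* Greedy colouring: a vertex of least rank is simplicial, hence can be coloured last. *)
Lemma perfect_graph_rank adj V (r : T -> nat) :
    {in V &, symmetric adj} ->
    (forall v u w, v \in V -> u \in V -> w \in V -> v != u -> v != w -> u != w ->
       adj v u -> adj v w -> r v <= r u -> r v <= r w -> adj u w) ->
  perfect_graph V adj.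
Proof.
move=> adjC simpl; apply: perfect_graph_colorable => S.
have [m leSm] := ubnP #|S|; elim: m S leSm => // m IHm S leSm SV.
have [->|[x0 Sx0]] := set_0Vmem S.
  by apply/existsP; exists [ffun=> ord0]; apply/andP; split; apply/forall_inP => x; rewrite inE.
have [v Sv vmin] := @arg_minnP _ x0 [in S] r Sx0.
have Vv : v \in V by apply: (subsetP SV).
pose S' := S :\ v.
have S'S : S' \subset S by apply: subD1set.
have [|c /andP[/forall_inP ck /forall_inP cP]] := existsP (IHm S' _ (subset_trans S'S SV)).
  by move: leSm; rewrite (cardsD1 v) Sv.
have kk' : clique_number adj S' <= clique_number adj S.
  apply/bigmax_leqP => C /andP[CS' Ccl]; apply: clique_numberP Ccl.
  exact: subset_trans CS' S'S.
set k := clique_number adj S in kk' *.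
pose Nb := [set u in S' | adj v u].
(* The neighbours of v in S' have rank at least that of v, so together with v they form a clique.
   Hence they occupy fewer than k colours, and one of the first k is left for v. *)
have ltNb : #|Nb| < k.
  have vNb : v \notin Nb by rewrite !inE eqxx.
  suff : #|v |: Nb| <= k by rewrite cardsU1 vNb.
  apply: clique_numberP.
    by apply/subsetP=> u /setU1P[-> //|]; rewrite !inE => /andP[/andP[]].
  have NbP u : u \in Nb -> [/\ u \in V, v != u, adj v u & r v <= r u].
    rewrite !inE => /andP[/andP[uv Su] vu].
    by rewrite (subsetP SV) // eq_sym vmin.
  apply/forall_inP=> u; rewrite in_setU1 => uNb.
  apply/forall_inP=> w; rewrite in_setU1 => wNb; apply/implyP=> uw.
  move: uNb wNb uw => /predU1P[->|/NbP[Vu vu avu ru]] /predU1P[->|/NbP[Vw vw avw rw]] //.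
  - by rewrite eqxx.
  - by rewrite adjC.
  by move=> uw; apply: (simpl v).
have [j jk jNb] : exists2 j : 'I_(#|T|.+1), j < k & j \notin c @: Nb.
  have /subsetPn[j] : ~~ ([set i : 'I_(#|T|.+1) | i < k] \subset c @: Nb).
    apply: contraL ltNb => /subset_leq_card; rewrite -leqNgt card_ltn_ord.
      by move/leq_trans; apply; apply: leq_imset_card.
    exact: leqW (clique_number_le_card _ _).
  by rewrite inE; exists j.
apply/existsP; exists [ffun x => if x == v then j else c x].
apply/andP; split; apply/forall_inP => x Sx.
  rewrite ffunE; case: eqP => // /eqP xv.
  by apply: leq_trans (ck x _) kk'; rewrite !inE xv.
have S'P y : y \in S -> y != v -> y \in S' by move=> Sy yv; rewrite !inE yv.
have Nbj y : y \in S -> y != v -> adj v y -> c y != j.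
  move=> Sy yv vy; apply: contraNneq jNb => <-.
  by apply/imsetP; exists y; rewrite // inE S'P.
apply/forall_inP => y Sy; apply/implyP=> /andP[xy axy]; rewrite !ffunE.
have [xv|xv] := eqVneq x v; have [yv|yv] := eqVneq y v.
- by rewrite xv yv eqxx in xy.
- by rewrite eq_sym Nbj // -xv.
- by rewrite Nbj // -yv adjC // (subsetP SV).
by apply: (implyP (forall_inP (cP x (S'P _ Sx xv)) y (S'P _ Sy yv))); rewrite xy.
Qed.

(** Despite its name a symmetric relation: adjacency in the n-cycle on 0, ..., n - 1. *)
Definition cyclic_succ n i j := [|| j == i.+1, i == j.+1,
  (i == 0) && (j == n.-1) | (j == 0) && (i == n.-1)].

(** A cycle of length at least 5 contains no triangle, while a 2-colouring alternates along it and
    fails at the closing edge when the length is odd. *)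
Lemma odd_hole_not_perfect adj V n (x : nat -> T) :
    odd n -> 3 < n -> {in gtn n &, injective x} ->
    (forall i, i < n -> x i \in V) ->
    (forall i j, i < n -> j < n -> i != j -> adj (x i) (x j) = cyclic_succ n i j) ->
  ~ perfect_graph V adj.
Proof.
move=> n_odd n_gt3 xinj xV adjx; pose S := [set x i | i : 'I_n in predT].
have SV : S \subset V by apply/subsetP=> _ /imsetP[i _ ->]; exact: xV (ltn_ord i).
move=> perfV; suff: clique_number adj S < chromatic_number adj S by rewrite perfV // ltnn.
have cl2 : clique_number adj S <= 2.
  apply/bigmax_leqP=> C /andP[/subsetP CS /forall_inP Ccl].
  rewrite leqNgt; apply/negP => /card_gt2P[a [b [c [[aC bC cC] [ab bc ca]]]]].
  have adjC u w : u \in C -> w \in C -> u != w -> adj u w.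
    by move=> uC wC; apply: implyP; apply: (forall_inP (Ccl u uC)).
  have := adjC a b aC bC ab; have := adjC b c bC cC bc; have := adjC c a cC aC ca.
  have [[i _ Ea] [j _ Eb] [k _ Ec]] := And3 (imsetP (CS a aC)) (imsetP (CS b bC)) (imsetP (CS c cC)).
  move: ab bc ca; rewrite Ea Eb Ec => ab bc ca.
  have nz (u w : 'I_n) : x u != x w -> u != w :> nat by apply: contraNneq => ->.
  rewrite !adjx ?nz // /cyclic_succ.
  move/nz: ab => /eqP; move/nz: bc => /eqP; move/nz: ca => /eqP.
  by have := ltn_ord i; have := ltn_ord j; have := ltn_ord k; move: (nat_of_ord i) (nat_of_ord j) (nat_of_ord k); lia.
apply: leq_ltn_trans cl2 _; rewrite ltnNge; apply/negP => chr2.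
(* The default value [#|T|] of the chromatic number is excluded, as the hole has more than 2
   vertices. *)
have S2 : colorable adj S 2.
  have [chrT|] := chromatic_number_colorable adj S.
    suff : n <= #|T| by rewrite -chrT; lia.
    rewrite -[n]card_ord -(@card_in_imset _ _ (fun i : 'I_n => x i) predT) ?max_card //.
    by move=> i j _ _ /xinj/val_inj; apply; rewrite inE.
  case/existsP=> c /andP[/forall_inP ck cP]; apply/existsP; exists c; rewrite cP andbT.
  by apply/forall_inP => y /ck cy; apply: leq_trans cy _.
case/existsP: S2 => c /andP[/forall_inP c2 /forall_inP cP].
have xS i : i < n -> x i \in S by move=> ltin; apply/imsetP; exists (Ordinal ltin).
have cN i j : i < n -> j < n -> i != j -> cyclic_succ n i j -> c (x i) != c (x j).
  move=> ltin ltjn ij sij; apply: (implyP (forall_inP (cP _ (xS _ ltin)) _ (xS _ ltjn))).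
  rewrite adjx // sij andbT; apply: contra_neq ij => /xinj-> //; exact: ltjn.
have par i : i < n -> c (x i) = (if odd i then 1 - c (x 0) else c (x 0)) :> nat.
  elim: i => // i IHi lti1n; have ltin := ltnW lti1n.
  have c0 := c2 _ (xS 0 (leq_ltn_trans (leq0n i) ltin)).
  have ci := c2 _ (xS _ lti1n); have := IHi ltin.
  have ii1 : i != i.+1 by lia.
  have := cN _ _ ltin lti1n ii1; rewrite /cyclic_succ eqxx -val_eqE /= => /(_ isT).
  by move: c0 ci; case: (odd i) => /=; move: (nat_of_ord (c (x 0))) (nat_of_ord (c (x i))) (nat_of_ord (c (x i.+1))); lia.
have n0 : 0 < n by lia.
have n1 : n.-1 < n by lia.
have /negP[] := cN 0 n.-1 n0 n1 ltac:(lia) ltac:(by rewrite /cyclic_succ !eqxx !orbT).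
rewrite -val_eqE /= (par n.-1) // -[X in odd X]subn1 oddB // n_odd /= eqxx.
by [].
Qed.

End Graphs.

(** * Permutations and matrices as lists *)

(* Unlike [has] and [all], these do not evaluate past the first deciding item under
   call-by-value; [if] is used below instead of [&&], [||] and [==>] for the same reason. *)
Section LazySeq.
Variables (T : Type) (a : pred T).
Fixpoint any s := if s is x :: s' then if a x then true else any s' else false.
Fixpoint every s := if s is x :: s' then if a x then every s' else false else true.
Lemma anyE s : any s = has a s.
Proof. by elim: s => //= x s ->; case: (a x). Qed.
Lemma everyE s : every s = all a s.
Proof. by elim: s => //= x s ->; case: (a x). Qed.
End LazySeq.

(** The order of the product is that of ['S_n]: s acts first. *)
Definition pcomp (s t : seq nat) := [seq nth 0 t i | i <- s].

Fixpoint eqs (s t : seq nat) : bool :=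
  match s, t with
  | [::], [::] => true
  | i :: s', j :: t' => if eqn i j then eqs s' t' else false
  | _, _ => false
  end.

Fixpoint eqm (A B : seq (seq nat)) : bool :=
  match A, B with
  | [::], [::] => true
  | u :: A', v :: B' => if eqs u v then eqm A' B' else false
  | _, _ => false
  end.

(* Vectors and matrices over 'F_7 are lists of numbers less than 7. *)
Definition addF : seq (seq nat) :=
  Eval vm_compute in [seq [seq (a + b) %% 7 | b <- iota 0 7] | a <- iota 0 7].
Definition mulF : seq (seq nat) :=
  Eval vm_compute in [seq [seq (a * b) %% 7 | b <- iota 0 7] | a <- iota 0 7].

Definition vscale a v := [seq nth 0 (nth [::] mulF a) b | b <- v].

Fixpoint vadd (u v : seq nat) :=
  match u, v with
  | a :: u', b :: v' => nth 0 (nth [::] addF a) b :: vadd u' v'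
  | _, _ => [::]
  end.

Fixpoint vmul (x : seq nat) (B : seq (seq nat)) : seq nat :=
  match x, B with
  | a :: x', r :: B' =>
      if a is 0 then vmul x' B' else vadd (vscale a r) (vmul x' B')
  | _, _ => nseq 6 0
  end.

Definition mmul A B := [seq vmul x B | x <- A].

(* A 3-cycle and a 7-cycle generating the alternating group of degree 7, with the matrices of
   lifts of them in a faithful 6-dimensional representation over 'F_7 of its 6-fold cover. *)
Definition genp (b : bool) : seq nat :=
  if b then [:: 1; 2; 3; 4; 5; 6; 0] else [:: 1; 2; 0; 3; 4; 5; 6].

Definition genm (b : bool) : seq (seq nat) :=
  if b then
    [:: [:: 0; 1; 0; 0; 0; 0]; [:: 0; 0; 1; 0; 0; 0]; [:: 0; 0; 0; 1; 0; 0];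
        [:: 0; 0; 0; 0; 1; 0]; [:: 0; 0; 0; 0; 0; 1]; [:: 6; 6; 6; 6; 6; 6]]
  else
    [:: [:: 5; 1; 1; 6; 4; 0]; [:: 4; 3; 3; 5; 0; 0]; [:: 0; 0; 4; 0; 0; 0];
        [:: 6; 1; 5; 0; 1; 0]; [:: 3; 0; 4; 0; 0; 0]; [:: 0; 3; 0; 6; 6; 2]].

Definition one_mx : seq (seq nat) := [seq [seq nat_of_bool (i == j) | j <- iota 0 6] | i <- iota 0 6].

(* An entry is a word in the generators, with its value as a permutation and as a matrix; the
   tree [lifts] is indexed by the first five values of the permutation. *)
Definition entry := (seq bool * seq nat * seq (seq nat))%type.
Inductive tree := Empty | Leaf of entry | Node of seq tree.

Fixpoint lookup (T : tree) (p : seq nat) : option entry :=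
  match T with
  | Empty => None
  | Leaf e => Some e
  | Node l => if p is i :: p' then lookup (nth Empty l i) p' else None
  end.

Fixpoint insert n (T : tree) (p : seq nat) (e : entry) : tree :=
  match n, p with
  | n'.+1, i :: p' =>
      let l := if T is Node l then l else nseq 7 Empty in
      Node (set_nth Empty l i (insert n' (nth Empty l i) p' e))
  | _, _ => Leaf e
  end.

(** One step of a breadth-first search through the group, by left multiplication with a generator;
    each permutation keeps the first word and matrix found for it. *)
Definition visit (st : tree * seq entry) (be : bool * entry) : tree * seq entry :=
  let: (T, new) := st in let: (b, (w, p, M)) := be in
  let q := pcomp (genp b) p in
  if lookup T q is Some _ then st else
  let e := (b :: w, q, mmul (genm b) M) in (insert 5 T q e, e :: new).

Fixpoint search fuel (T : tree) (front : seq entry) : tree :=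
  if fuel is fuel'.+1 then
    let: (T', new) := foldl visit (T, [::]) [seq (b, e) | b <- [:: true; false], e <- front] in
    search fuel' T' new
  else T.

(** That 20 rounds reach all of A_7 is confirmed afterwards by [check_alt]. *)
Definition lifts : tree := Eval vm_compute in
  let e := ([::], iota 0 7, one_mx) in search 20 (insert 5 Empty (iota 0 7) e) [:: e].

Definition evalw (w : seq bool) := foldr (fun b p => pcomp (genp b) p) (iota 0 7) w.

(** Five values determine an even permutation of 7 points, hence the depth 5 of the tree. Comparison
    with the stored q rejects the odd permutation that has the same first five values. *)
Definition even (p : seq nat) :=
  if lookup lifts p is Some (w, q, _) then eqs q p else false.
Definition word (p : seq nat) :=
  if lookup lifts p is Some (w, _, _) then w else [::].
Definition liftm (p : seq nat) :=
  if lookup lifts p is Some (_, _, M) then M else [::].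

(* Can the images p of 0, ..., m - 1 under a permutation commuting with v be extended by j? *)
Definition good (v p : seq nat) m j :=
  let vm := nth 0 v m in let i := find (eqn m) v in
  if any (eqn j) p then false else
  if (vm <= m) && ~~ eqn (nth 0 v j) (nth 0 (rcons p j) vm) then false else
  if i < m then eqn j (nth 0 v (nth 0 p i)) else true.

(** Incompatible prefixes are cut off early, so a centraliser is listed without running through all
    permutations. *)
Fixpoint cent_prefixes (v : seq nat) m : seq (seq nat) :=
  if m is m'.+1 then
    flatten [seq [seq rcons p j | j <- iota 0 (size v) & good v p m' j] | p <- cent_prefixes v m']
  else [:: [::]].
Definition cent v := cent_prefixes v (size v).

Definition perms7 := cent (iota 0 7).

Definition prop_mx A B := any (fun l => eqm A [seq vscale l r | r <- B]) (iota 1 6).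

Definition wfm (A : seq (seq nat)) :=
  (size A == 6) && every (fun r => (size r == 6) && every (fun a => a < 7) r) A.

(* Up to scalars, [liftm] is multiplicative on products by a generator. *)
Definition check_mul p := 
  if ~~ even p then true else [&& eqs (evalw (word p)) p, wfm (liftm p) &
    every (fun b => even (pcomp (genp b) p) && prop_mx (mmul (genm b) (liftm p)) (liftm (pcomp (genp b) p)))
        [:: true; false]].

(** An even permutation missing from [lifts] would fail this test, since its product with the
    transposition of 0 and 1 is odd and the table holds even permutations only. *)
Definition check_alt p := even p || even (pcomp p [:: 1; 0; 2; 3; 4; 5; 6]).

Definition fixn (p : seq nat) := count (fun i => eqn i (nth 0 p i)) (iota 0 (size p)).

Definition noncomm A B :=
  any (fun k => ~~ eqs (vmul (nth [::] A k) B) (vmul (nth [::] B k) A)) (iota 0 6).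

(** Seven powers suffice, as no element of A_7 has order above 7. *)
Definition powers z := traject (pcomp^~ z) (iota 0 (size z)) 7.

(* The elements u with at least as many fixed points as v, whose lifts commute with that of v,
   all lie in one cyclic subgroup. *)
Definition check_cyclic v :=
  if ~~ even v then true else
  let M := liftm v in let k := fixn v in
  let N := filter (fun u => if k <= fixn u then even u else false) (cent v) in
  (* If v and u commute and have coprime orders, then v u generates both; this suggests the
     candidates for z. *)
  any (fun z => let Z := powers z in
         every (fun u => if any (eqs u) Z then true else noncomm M (liftm u)) N)
      (v :: [seq pcomp v u | u <- N]).

Definition check_all p := [&& check_mul p, check_alt p & check_cyclic p].

Lemma check_all_perms7 : every check_all perms7.
Proof. by vm_cast_no_check (erefl true). Qed.

Definition inv3 (a : seq nat) := pcomp a a.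
Definition cycles3 := [:: [:: 1; 2; 0; 3]; [:: 0; 2; 3; 1]; [:: 1; 3; 2; 0]; [:: 2; 1; 3; 0]; [:: 2; 0; 1; 3]].
(** The derived group of A_4 is the four-group, of index 3: an even p is a commutator of two
    3-cycles times a power of the 3-cycle (0 1 2). The second alternative serves the odd p. *)
Definition check_Alt4 p := any (fun a => any (fun b => any (fun k =>
  let q := pcomp (pcomp (pcomp (inv3 a) (inv3 b)) (pcomp a b))
                 (iter k (pcomp [:: 1; 2; 0; 3]) (iota 0 4)) in
  eqs p q || eqs (pcomp p [:: 1; 0; 2; 3]) q) (iota 0 3)) cycles3) cycles3.
Lemma check_Alt4_perms : every check_Alt4 (cent (iota 0 4)).
Proof. by vm_compute. Qed.

Local Open Scope group_scope.

Lemma eqsP s t : reflect (s = t) (eqs s t).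
Proof.
apply: (iffP idP) => [|<-]; last first.
  by elim: s => //= i s IHs; case: eqnP.
elim: s t => [|i s IHs] [|j t] //=.
by case: eqnP => // -> /IHs->.
Qed.

Lemma eqmP A B : reflect (A = B) (eqm A B).
Proof.
apply: (iffP idP) => [|<-]; last by elim: A => //= u A IHA; case: eqsP.
elim: A B => [|u A IHA] [|v B] //=.
by case: eqsP => // -> /IHA->.
Qed.

(** * Permutations and their lists of values *)

Section Code.
Variable n : nat.
Implicit Types s t : 'S_n.

Definition code s : seq nat := [seq val (s i) | i <- enum 'I_n].

Lemma size_code s : size (code s) = n.
Proof. by rewrite size_map size_enum_ord. Qed.

Lemma code_eq s (f : nat -> nat) : (forall i, s i = f i :> nat) -> code s = map f (iota 0 n).
Proof. by move=> sf; rewrite -val_enum_ord -map_comp; apply: eq_map => i /=. Qed.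

Lemma nth_code s (i : 'I_n) : nth 0 (code s) i = s i.
Proof. by rewrite (nth_map i) ?size_enum_ord // nth_ord_enum. Qed.

Lemma code_inj : injective code.
Proof. by move=> s t st; apply/permP => i; apply: val_inj; rewrite /= -!nth_code st. Qed.

Lemma code1 : code 1 = iota 0 n.
Proof. by rewrite (@code_eq _ id) ?map_id // => i; rewrite perm1. Qed.

Lemma codeM s t : code (s * t) = pcomp (code s) (code t).
Proof. by rewrite /pcomp /code -map_comp; apply: eq_map => i /=; rewrite nth_code permM. Qed.

Lemma code_uniq s : uniq (code s).
Proof. by rewrite map_inj_uniq ?enum_uniq // => i j /val_inj/perm_inj. Qed.

Definition decode (l : seq nat) : 'S_n := odflt 1%g [pick s | code s == l].

Lemma decodeK l : perm_eq l (iota 0 n) -> code (decode l) = l.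
Proof.
move=> ln; rewrite /decode; case: pickP => [s /eqP // | no_s].
have szl : size l = n by rewrite (perm_size ln) size_iota.
have lt_l i : i < n -> nth 0 l i < n.
  move=> ltin; have: nth 0 l i \in l by rewrite mem_nth ?szl.
  by rewrite (perm_mem ln) mem_iota.
pose f (i : 'I_n) := Ordinal (lt_l i (ltn_ord i)).
have f_inj : injective f.
  move=> i j /(congr1 val)/eqP /=; rewrite nth_uniq ?szl // ?(perm_uniq ln) ?iota_uniq //.
  by move/eqP/val_inj.
case/eqP: (no_s (perm f_inj)).
rewrite (@code_eq _ (nth 0 l)) => [|i]; last by rewrite permE.
by rewrite -szl -/(mkseq _ _) mkseq_nth.
Qed.

(** Each prefix of [code t] passes the tests of [good]: the first by injectivity of t, the other two
    as instances of s (t i) = t (s i). *)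
Lemma mem_cent s t : commute s t -> code t \in cent (code s).
Proof.
move=> cst; have cstE i : s (t i) = t (s i) by rewrite -!permM cst.
rewrite /cent size_code.
have : take n (code t) \in cent_prefixes (code s) n; last first.
  by rewrite -{1}(size_code t) take_size.
elim: {-2}n (leqnn n) => [_|m IHm ltmn]; first by rewrite take0 mem_head.
apply/flatten_mapP; exists (take m (code t)); first exact: IHm (ltnW ltmn).
pose j := nth 0 (code t) m; have jE : j = t (Ordinal ltmn) :> nat by rewrite /j (nth_code t (Ordinal ltmn)).
have takeS : rcons (take m (code t)) j = take m.+1 (code t).
  by rewrite (take_nth 0) // size_code.
apply/mapP; exists j => //; rewrite mem_filter mem_iota /= add0n size_code jE ltn_ord andbT -jE.
rewrite /good anyE; case: ifP => [/hasP[k] | _].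
  move=> kt /eqnP jk; have := code_uniq t; rewrite -(cat_take_drop m.+1 (code t)) cat_uniq -takeS.
  by rewrite rcons_uniq jk kt.
case: ifP => [/andP[le_vm] | _].
  case: eqnP => // -[]; rewrite takeS; move: le_vm.
  rewrite (nth_code s (Ordinal ltmn)) => le_vm; rewrite nth_take // jE !nth_code.
  by rewrite cstE.
case: ifP => // lt_im; set i := find _ _ in lt_im *.
have has_i : has (eqn m) (code s) by rewrite has_find size_code (ltn_trans lt_im).
have ltin : i < n by rewrite -[n](size_code s) -has_find.
have /eqnP mE := nth_find 0 has_i; rewrite -/i (nth_code s (Ordinal ltin)) in mE.
apply/eqnP; rewrite nth_take // (nth_code t (Ordinal ltin)) nth_code cstE jE.
by congr (val (t _)); apply: val_inj.
Qed.

Lemma cent_code s l : l \in cent (code s) -> exists t, code t = l.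
Proof.
rewrite /cent size_code => ln; exists (decode l); apply: decodeK.
have pref m p : p \in cent_prefixes (code s) m -> [/\ size p = m, uniq p & {subset p <= iota 0 n}].
  elim: m p => [|m IHm] q /=; first by rewrite inE => /eqP->.
  case/flatten_mapP=> p /IHm[sp up ltp] /mapP[j].
  rewrite mem_filter size_code /good anyE => /andP[+ jn ->].
  case: ifP => // /hasPn/= jp _; split; first by rewrite size_rcons sp.
    by rewrite rcons_uniq up andbT; apply/negP => /jp/eqnP.
  by move=> i; rewrite mem_rcons inE => /predU1P[->|/ltp].
have [szl ul ltl] := pref n l ln; apply: uniq_perm; rewrite ?iota_uniq //.
by case: (uniq_min_size ul ltl); rewrite ?size_iota ?szl.
Qed.

End Code.

(** * Lists of numbers as vectors and matrices over the field with 7 elements *)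

Section Matrices.
Local Open Scope ring_scope.
Local Notation F := 'F_7.

Definition wfv (u : seq nat) := (size u == 6) && all (fun a => a < 7)%N u.

Lemma wfmE A : wfm A = (size A == 6) && all wfv A.
Proof. by rewrite /wfm everyE; congr andb; apply: eq_all => u; rewrite everyE. Qed.

Lemma natrF_mod k : ((k %% 7)%N%:R : F) = k%:R.
Proof. by rewrite Fp_nat_mod. Qed.

Lemma natrF_inj a b : (a < 7 -> b < 7 -> (a%:R : F) = b%:R -> a = b)%N.
Proof. by move=> lta ltb /(congr1 val); rewrite /= !val_Fp_nat // !modn_small. Qed.

Lemma addFE a b : (a < 7 -> b < 7 -> nth 0 (nth [::] addF a) b = (a + b) %% 7)%N.
Proof. by do 7?[case: a => [|a] //]; do 7?[case: b => [|b] //]. Qed.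

Lemma mulFE a b : (a < 7 -> b < 7 -> nth 0 (nth [::] mulF a) b = (a * b) %% 7)%N.
Proof. by do 7?[case: a => [|a] //]; do 7?[case: b => [|b] //]. Qed.

Lemma wfv_size u : wfv u -> size u = 6. Proof. by case/andP=> /eqP. Qed.

Lemma wfv_lt u j : wfv u -> (nth 0 u j < 7)%N.
Proof.
case/andP=> /eqP su /allP u7; have [ltj|lej] := ltnP j (size u); last by rewrite nth_default.
by rewrite u7 ?mem_nth.
Qed.

Lemma wfv_vscale a v : (a < 7)%N -> wfv v -> wfv (vscale a v).
Proof.
move=> a7 vw; rewrite /wfv size_map (wfv_size vw) /=; apply/allP => _ /mapP[b bv ->].
by case/andP: vw => _ /allP/(_ b bv) b7; rewrite mulFE // ltn_pmod.
Qed.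

Lemma vscaleE a v j : (a < 7)%N -> wfv v ->
  (nth 0 (vscale a v) j)%:R = a%:R * (nth 0 v j)%:R :> F.
Proof.
move=> a7 vw; have [ltj|lej] := ltnP j (size v); last first.
  by rewrite !nth_default ?size_map // mulr0.
by rewrite (nth_map 0) // mulFE ?wfv_lt // natrF_mod natrM.
Qed.

Lemma size_vadd u v : size (vadd u v) = minn (size u) (size v).
Proof. by elim: u v => [|a u IHu] [|b v] //=; rewrite IHu minnSS. Qed.

Lemma nth_vadd u v j : size u = size v -> all (fun a => a < 7)%N u -> all (fun a => a < 7)%N v ->
  nth 0 (vadd u v) j = ((nth 0 u j + nth 0 v j) %% 7)%N.
Proof.
elim: u v j => [|a u IHu] [|b v] [|j] //= [suv] /andP[a7 u7] /andP[b7 v7]; last exact: IHu.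
exact: addFE.
Qed.

Lemma wfv_vadd u v : wfv u -> wfv v -> wfv (vadd u v).
Proof.
move=> uw vw; rewrite /wfv size_vadd (wfv_size uw) (wfv_size vw) /=.
apply/(all_nthP 0) => j _; case/andP: uw (uw) => _ u7 uw; case/andP: vw (vw) => _ v7 vw.
by rewrite nth_vadd ?(wfv_size uw) ?(wfv_size vw) // ltn_pmod.
Qed.

Lemma vaddE u v j : wfv u -> wfv v ->
  (nth 0 (vadd u v) j)%:R = (nth 0 u j)%:R + (nth 0 v j)%:R :> F.
Proof.
move=> uw vw; case/andP: uw (uw) => _ u7 uw; case/andP: vw (vw) => _ v7 vw.
by rewrite nth_vadd ?(wfv_size uw) ?(wfv_size vw) // natrF_mod natrD.
Qed.

Lemma vmulE x B : all (fun a => a < 7)%N x -> all wfv B -> size x = size B ->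
  wfv (vmul x B) /\
  forall j, (nth 0 (vmul x B) j)%:R = \sum_(k < size x) (nth 0 x k)%:R * (nth 0 (nth [::] B k) j)%:R :> F.
Proof.
elim: x B => [|a x IHx] [|r B] //=.
  move=> _ _ _; split=> // j; rewrite big_ord0.
  by do 6![case: j => [|j] //=]; rewrite nth_nil.
case/andP=> a7 x7 /andP[rw Bw] [sxB]; have [w E] := IHx B x7 Bw sxB.
have arw := wfv_vscale a7 rw; case: a a7 arw => [|a] a7 arw; split=> //.
- by move=> j; rewrite big_ord_recl /= mul0r add0r E.
- exact: wfv_vadd.
by move=> j; rewrite vaddE // vscaleE // big_ord_recl /= E.
Qed.

Definition mx (A : seq (seq nat)) : 'M[F]_6 := \matrix_(i, j) (nth 0%N (nth [::] A i) j)%:R.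

Lemma wfm_nth A k : wfm A -> (k < 6)%N -> wfv (nth [::] A k).
Proof. by rewrite wfmE => /andP[/eqP sA /allP Aw] k6; rewrite Aw ?mem_nth ?sA. Qed.

Lemma vmul_mx A B k (k6 : (k < 6)%N) : wfm A -> wfm B ->
  wfv (vmul (nth [::] A k) B) /\
  forall j : 'I_6, (nth 0%N (vmul (nth [::] A k) B) j)%:R = (mx A *m mx B) (Ordinal k6) j.
Proof.
move=> Aw Bw; have rw := wfm_nth Aw k6.
have [/andP[/eqP sB Bw'] /andP[_ r7]] : ((size B == 6) && all wfv B) /\ wfv (nth [::] A k) by rewrite -wfmE.
have [|w E] := vmulE r7 Bw'; first by rewrite sB (wfv_size rw).
split=> // j; rewrite E (wfv_size rw) mxE; apply: eq_bigr => i _.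
by rewrite !mxE.
Qed.

Lemma mx_mmul A B : wfm A -> wfm B -> mx (mmul A B) = mx A *m mx B.
Proof.
move=> Aw Bw; apply/matrixP => i j; rewrite mxE; case: i => i i6.
have /andP[/eqP sA _] := Aw.
by have [_ <-] := vmul_mx i6 Aw Bw; rewrite /= (nth_map [::]) ?sA.
Qed.

Lemma prop_mxP A B : wfm B -> prop_mx A B -> exists2 l : F, l != 0 & mx A = l *: mx B.
Proof.
move=> Bw; rewrite /prop_mx anyE => /hasP[l]; rewrite mem_iota => /andP[l0 l7] /eqmP->.
exists l%:R; first by apply/eqP => /(@natrF_inj l 0 l7 isT) l00; rewrite l00 in l0.
apply/matrixP => i j; rewrite !mxE; have /andP[/eqP sB _] := Bw.
by rewrite (nth_map [::]) ?sB // vscaleE // wfm_nth.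
Qed.

Lemma noncommP A B : wfm A -> wfm B -> noncomm A B -> mx A *m mx B <> mx B *m mx A.
Proof.
move=> Aw Bw; rewrite /noncomm anyE => /hasP[k]; rewrite mem_iota /= => k6 /eqsP nAB AB.
have [wAB EAB] := vmul_mx k6 Aw Bw; have [wBA EBA] := vmul_mx k6 Bw Aw.
case: nAB; apply: (@eq_from_nth _ 0%N) => [|j]; rewrite !wfv_size // => j6.
apply: natrF_inj; rewrite ?wfv_lt //.
by have := EAB (Ordinal j6); rewrite AB -EBA.
Qed.

End Matrices.

(** * Central extensions and Schur covers *)

Lemma exists_order n : 0 < n ->
  exists (cT : finGroupType) (c : cT), abelian [set: cT] /\ #[c] = n.
Proof.
case: n => // n _; exists 'I_n.+1, Zp1; split; first exact: Zp_abelian.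
exact: order_Zp1.
Qed.

Lemma card_ker_morphim (aT rT : finGroupType) (D : {group aT}) (f : {morphism D >-> rT}) :
  (#|'ker f| * #|f @* D|)%N = #|D|.
Proof. by rewrite card_morphim setIid Lagrange ?subsetIl. Qed.

Lemma commute_pair (aT bT : finGroupType) (z w : aT * bT) :
  commute z w <-> commute z.1 w.1 /\ commute z.2 w.2.
Proof. by split=> [[? ?] | [? ?]] //; congr (_, _). Qed.

(* In P x C, with C cyclic, the element t over x is replaced by (t, c), so that its m-th power
   can be corrected by the central element (a, c ^ m) without meeting P^`(1). *)
Lemma stem_of_central (gT pT : finGroupType) (G : {group gT}) (P : {group pT})
    (F : {morphism P >-> gT}) x :
    F @* P = G -> 'ker F \subset 'Z(P) -> x \in G -> G \subset G^`(1) <*> <[x]> ->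
  exists (kT : finGroupType) (K : {group kT}) (g : {morphism K >-> gT}),
    stem_extension G g /\ #|G| * #|'ker F :&: P^`(1)| <= #|K|.
Proof.
move=> FP sAZ Gx sG; set A := 'ker F in sAZ *; set D := P^`(1).
have sDP : D \subset P := der_sub 1 P.
have FD : F @* D = G^`(1) by rewrite morphim_der ?FP.
have [t Pt xE] : exists2 t, t \in P & x = F t.
  by move: Gx; rewrite -FP => /morphimP[t Pt _ ->]; exists t.
have sAP : A \subset P := subset_trans sAZ (center_sub P).
have FA a : a \in A -> F a = 1 by move=> Aa; apply/mker.
have cA a p : a \in A -> p \in P -> commute a p.
  by move=> Aa Pp; have /centerP[_] := subsetP sAZ a Aa; apply.
have nG'x : x \in 'N(G^`(1)) by apply: (subsetP (der_norm 1 G)).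
(* m is the order of x modulo the derived group of G; thus t ^+ m splits as d * a with d in D and a
   in A. *)
pose m := #[coset G^`(1) x].
have mP k : (x ^+ k \in G^`(1)) = (m %| k).
  rewrite order_dvdn -morphX //; apply/idP/eqP; first exact: coset_id.
  by apply: coset_idr; rewrite groupX.
have [d Dd Fd] : exists2 d, d \in D & F d = F (t ^+ m).
  have : x ^+ m \in G^`(1) by rewrite mP.
  by rewrite -FD xE -morphX // => /morphimP[d Pd Dd ->]; exists d.
have Pd := subsetP sDP d Dd.
pose a := d^-1 * t ^+ m.
have Aa : a \in A by rewrite !inE groupM ?groupV ?groupX //= morphM ?groupV ?groupX // morphV // Fd mulVg.
have Pa := subsetP sAP a Aa.
have tm : t ^+ m = d * a by rewrite mulKVg.
(* With this order of c, a power of (a, c ^+ m) is trivial as soon as its second component is; hence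
   N below meets D x 1 trivially. *)
have [cT [c [cTab cord]]] : exists (cT : finGroupType) (c : cT), abelian [set: cT] /\ #[c] = (m * #[a])%N.
  by apply: exists_order; rewrite muln_gt0 !order_gt0.
have cC (u v : cT) : commute u v by apply: (centsP cTab); rewrite inE.
pose D1 := [group of setX D [1 cT]].
have D1E u v : ((u, v) \in D1) = (u \in D) && (v == 1) by rewrite !inE.
pose tc : pT * cT := (t, c).
have tcX k : tc ^+ k = (t ^+ k, c ^+ k).
  by elim: k => // k IHk; rewrite !expgS IHk.
have nDtc : <[tc]> \subset 'N(D1).
  rewrite cycle_subG inE; apply/subsetP => _ /imsetP[[u v] uv ->].
  move: uv; rewrite D1E => /andP[Du /eqP->].
  rewrite (_ : (u, 1) ^ tc = (u ^ t, 1 ^ c)) // D1E conj1g eqxx andbT.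
  by rewrite memJ_norm ?(subsetP (der_norm 1 P)).
pose T := [group of D1 <*> <[tc]>].
have TP z : z \in T -> exists2 e, e \in D & exists k, z = (e * t ^+ k, c ^+ k).
  rewrite /T /= norm_joinEr // => /mulsgP[[e v] _ eD /cycleP[k ->] ->].
  move: eD; rewrite D1E => /andP[De /eqP->]; exists e => //; exists k.
  by rewrite tcX /= -[c ^+ k in RHS]mul1g.
have sD1T : D1 \subset T := joing_subl _ _.
have Ttc : tc \in T by rewrite -cycle_subG joing_subr.
have T1 z : z \in T -> z.1 \in P.
  by case/TP=> e De [k ->] /=; rewrite groupM ?groupX // (subsetP sDP).
have FmM : {in T &, {morph (fun z : pT * cT => F z.1) : z w / z * w}}.
  by move=> z w Tz Tw; rewrite morphM ?T1.
pose Fm := Morphism FmM.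
have FmE z : Fm z = F z.1 by [].
have FmT : Fm @* T = G.
  apply/eqP; rewrite eqEsubset; apply/andP; split.
    by apply/subsetP => _ /morphimP[z _ Tz ->]; rewrite FmE -FP mem_morphim ?T1.
  apply: subset_trans sG _; rewrite join_subG cycle_subG; apply/andP; split.
    rewrite -FD; apply/subsetP => _ /morphimP[e Pe De ->].
    by rewrite -(FmE (e, 1 : cT)) mem_morphim ?(subsetP sD1T) ?D1E ?De //=.
  by rewrite xE -(FmE tc) mem_morphim.
pose n0 : pT * cT := (a, c ^+ m).
have tcm : tc ^+ m = (d, 1) * n0 by rewrite tcX tm /n0 -[c ^+ m in LHS]mul1g.
have Tn0 : n0 \in T.
  have -> : n0 = (d, 1)^-1 * tc ^+ m by rewrite tcm mulKg.
  by rewrite groupM ?groupX // groupV (subsetP sD1T) // D1E Dd /=.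
pose N := [group of <[n0]>].
have sNT : N \subset T by rewrite cycle_subG.
have cPA e z : e.1 \in A -> z \in T -> commute (e : pT * cT) z.
  by move=> Ae /T1 Pz; apply/commute_pair; split; [apply: cA | apply: cC].
have nNT : T \subset 'N(N).
  apply: cents_norm; apply/centsP => z Tz _ /cycleP[k ->].
  by apply/commuteX/commute_sym/cPA.
have n0X k : n0 ^+ k = (a ^+ k, c ^+ (m * k)).
  by rewrite expgM; elim: k => // k IHk; rewrite !expgS IHk.
have ND1 e : (e, 1) \in N -> e = 1.
  case/cycleP=> k; rewrite n0X => -[-> /esym/eqP].
  rewrite -order_dvdn cord dvdn_pmul2l ?order_gt0 // order_dvdn => /eqP //.
(* For a kernel element (e * t ^+ k, c ^+ k), the power x ^+ k lies in the derived group, so m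
   divides k; then (t, c) ^+ m = (d, 1) * n0 trades t for d. Modulo N the kernel thus comes from A
   :&: D. *)
have kerP z : z \in 'ker Fm -> exists2 e, e \in A :&: D & exists k, z = (e, 1) * n0 ^+ k.
  case/morphpreP=> /TP[e De [k ->]] /set1P; rewrite FmE /= => Fek.
  have Pe := subsetP sDP e De.
  have /dvdnP[j kE] : m %| k.
    rewrite -mP xE -morphX //.
    have G'e : F e \in G^`(1) by rewrite -FD mem_morphim.
    rewrite -(groupMl _ G'e).
    by rewrite -morphM ?groupX // Fek group1.
  have cdn : commute (d, 1) n0.
    by apply/commute_pair; split; [apply/commute_sym/cA | apply: cC].
  have zE : (e * t ^+ k, c ^+ k) = ((e * d ^+ j, 1) : pT * cT) * n0 ^+ j.
    have -> : (e * t ^+ k, c ^+ k) = ((e, 1) : pT * cT) * tc ^+ k.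
      by rewrite tcX; congr (_, _); rewrite mul1g.
    rewrite kE mulnC expgM tcm expgMn // mulgA; congr (_ * _).
    elim: (j) => [|i IHi]; first by rewrite !expg0 !mulg1.
    by rewrite !expgSr !mulgA IHi; congr (_, _); rewrite mulg1.
  exists (e * d ^+ j); last by exists j.
  rewrite inE (groupM De) ?groupX // andbT !inE groupM ?groupX //=.
  have := congr1 (fun z : pT * cT => F z.1) zE; rewrite n0X /= Fek.
  have FAj : F (a ^+ j) = 1 by rewrite FA ?groupX.
  rewrite [in X in _ = X -> _]morphM ?(groupM Pe) ?groupX // FAj mulg1 => <-.
  exact: eqxx.
have Kq : 'ker (coset_morphism N) \subset 'ker Fm.
  by rewrite ker_coset cycle_subG !inE Tn0 /= FA.
(* The projection R of T satisfies R A = P with A central, so R and P have the same derived group.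
   As cT is abelian, it follows that D x 1 lies in the derived group of T. *)
pose R := [group of fst_morphism pT cT @* T].
have RP : R^`(1) = D.
  have sRP : R \subset P by apply/subsetP => _ /morphimP[z _ /T1 Pz ->].
  have defP : R \* A = P.
    rewrite cprodE; last first.
      by apply/centsP => y Ay r Rr; apply: cA => //; apply: (subsetP sRP).
    apply/eqP; rewrite eqEsubset mul_subG //; apply/subsetP => p Pp.
    have : F p \in Fm @* T by rewrite FmT -FP mem_morphim.
    case/morphimP=> z _ Tz; rewrite FmE => Fpz; rewrite -(mulKVg z.1 p).
    apply: mem_mulg; first by apply/morphimP; exists z; rewrite ?inE.
    by rewrite !inE groupM ?groupV ?T1 //= morphM ?groupV ?T1 // morphV ?T1 // Fpz mulVg.
  have := der_cprod 1 defP; rewrite (_ : A^`(1) = 1) ?cprodg1 //.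
  apply/derG1P; apply/centsP => y Ay y' Ay'; apply: cA => //.
  exact: (subsetP sAP).
have sDT e : e \in D -> (e, 1) \in T^`(1).
  rewrite -RP /= -morphim_der ?subsetT // => /morphimP[[u v] _ T'uv /= ->].
  have : v \in snd_morphism pT cT @* T^`(1).
    by apply/morphimP; exists (u, v); rewrite ?inE.
  rewrite morphim_der ?subsetT // (_ : _^`(1) = 1) => [/set1P <- //|].
  by apply/derG1P; apply: abelianS (subsetT _) cTab.
pose K := [group of coset_morphism N @* T].
pose g : {morphism K >-> gT} := [morphism of factm Kq nNT].
have kerg : 'ker g = coset_morphism N @* 'ker Fm by apply: ker_factm.
have e1 e : e \in A :&: D -> [/\ (e, 1) \in T, (e, 1) \in 'ker Fm & (e, 1) \in 'Z(T)].
  case/setIP=> Ae De; have Te : (e, 1) \in T by rewrite (subsetP sD1T) // D1E De /=.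
  split=> //; first by rewrite !inE Te /= FA.
  by rewrite inE Te; apply/centP => z Tz; apply: cPA.
exists (coset_of N), K, g; split; first split.
- by rewrite /g /= morphim_factm.
- rewrite kerg; apply/subsetP => _ /morphimP[z nz /kerP[e ADe [k ->]] ->].
  have [Te _ Ze] := e1 e ADe.
  rewrite morphM ?(subsetP nNT) ?groupX // [coset_morphism N (n0 ^+ k)]coset_id ?mem_cycle // mulg1.
  rewrite inE (subsetP (morphim_center _ _)) ?mem_morphim ?(subsetP nNT) //=.
  rewrite /K /= -morphim_der // mem_morphim ?(subsetP nNT) //.
  by apply: sDT; case/setIP: ADe.
have <- : (#|'ker g| * #|G|)%N = #|K|.
  by rewrite -(card_ker_morphim g) /= morphim_factm FmT.
rewrite mulnC leq_mul2r; apply/orP; right.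
(* Since N meets D x 1 trivially, A :&: D embeds in the kernel of g. *)
have inj : {in A :&: D &, injective (fun e => coset N (e, 1))}.
  move=> e e' ADe ADe' /= eqe; have [[Te _ _] [Te' _ _]] := (e1 e ADe, e1 e' ADe').
  apply/eqP; rewrite eq_mulgV1; apply/eqP/ND1.
  have -> : (e * e'^-1, 1) = ((e, 1) : pT * cT) * (e', 1)^-1.
    by congr (_, _); rewrite mulgV.
  apply: coset_idr; first by rewrite (subsetP nNT) // groupM ?groupV.
  by rewrite morphM ?morphV ?groupV ?(subsetP nNT) //= eqe mulgV.
rewrite -(card_in_imset inj); apply/subset_leq_card/subsetP => _ /imsetP[e ADe ->].
by rewrite kerg mem_morphim; have [Te ? _] := e1 e ADe; rewrite ?(subsetP nNT).
Qed.

(* The fibre product P of H and K over bT is a central extension of G, and a stem extension with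
   kernel 'ker F :&: P^`(1) has order at most #|H|: so the first projection, which maps this
   kernel onto 'ker f, is injective on it. *)
Lemma schur_cover_commute (gT hT kT bT : finGroupType) (G : {group gT}) (H : {group hT})
    (f : {morphism H >-> gT}) (K : {group kT}) (pi : {morphism K >-> bT})
    (iota : {morphism G >-> bT}) x :
    schur_cover G f -> 'ker pi \subset 'Z(K) -> iota @* G \subset pi @* K ->
    x \in G -> G \subset G^`(1) <*> <[x]> ->
  forall h1 h2 k1 k2, h1 \in H -> h2 \in H -> k1 \in K -> k2 \in K ->
    pi k1 = iota (f h1) -> pi k2 = iota (f h2) -> commute h1 h2 -> commute k1 k2.
Proof.
move=> [[fH sZ] maxH] sKZ sGK Gx sG h1 h2 k1 k2 Hh1 Hh2 Kk1 Kk2 E1 E2 ch.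
have Gf h : h \in H -> f h \in G by move=> Hh; rewrite -fH mem_morphim.
pose P0 := [set z : hT * kT | [&& z.1 \in H, z.2 \in K & pi z.2 == iota (f z.1)]].
have P0P z : reflect [/\ z.1 \in H, z.2 \in K & pi z.2 = iota (f z.1)] (z \in P0).
  by rewrite inE; apply: (iffP and3P) => -[? ? /eqP].
have gP0 : group_set P0.
  apply/group_setP; split=> [|z w /P0P[Hz Kz Ez] /P0P[Hw Kw Ew]]; apply/P0P.
    by rewrite !group1 !morph1.
  by rewrite !groupM ?morphM ?Ez ?Ew ?Gf.
pose P := group gP0.
have FM : {in P &, {morph (fun z : hT * kT => f z.1) : z w / z * w}}.
  by move=> z w /P0P[Hz _ _] /P0P[Hw _ _]; rewrite morphM.
pose F := Morphism FM.
have FE z : F z = f z.1 by [].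
have fstP h : h \in H -> exists2 z, z \in P & z.1 = h.
  move=> Hh; have : iota (f h) \in pi @* K by apply: (subsetP sGK); rewrite mem_morphim ?Gf.
  by case/morphimP=> k _ Kk E; exists (h, k) => //; apply/P0P.
have FP : F @* P = G.
  apply/eqP; rewrite eqEsubset; apply/andP; split; apply/subsetP.
    by move=> _ /morphimP[z _ /P0P[Hz _ _] ->]; apply: Gf.
  move=> y; rewrite -fH => /morphimP[h Hh _ ->]; have [z Pz <-] := fstP h Hh.
  by rewrite -FE mem_morphim.
have kerF z : z \in 'ker F -> [/\ z \in P, z.1 \in 'ker f & z.2 \in 'ker pi].
  case/morphpreP=> Pz /set1P; rewrite FE => fz; have [Hz Kz Ez] := P0P _ Pz.
  by split; rewrite // !inE ?Hz ?Kz ?Ez fz ?morph1 /=.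
have sFZ : 'ker F \subset 'Z(P).
  apply/subsetP => z /kerF[Pz fz pz]; rewrite inE Pz; apply/centP => w /P0P[Hw Kw _].
  have /setIP[/centerP[_ cz1] _] := subsetP sZ _ fz.
  have /centerP[_ cz2] := subsetP sKZ _ pz.
  by apply/commute_pair; split; [apply: cz1 | apply: cz2].
have [lT [L [g [stemg leL]]]] := stem_of_central FP sFZ Gx sG.
have {leL stemg lT L g} leFf : #|'ker F :&: P^`(1)| <= #|'ker f|.
  have := leq_trans leL (maxH _ _ _ stemg).
  by rewrite -(card_ker_morphim f) fH mulnC leq_pmul2r ?cardG_gt0.
(* The derived group of H is the image of that of P, so elements of 'ker f lift to the latter. The
   lifts lie in 'ker F because F depends on the first component only. *)
have fstD : 'ker f \subset fst_morphism hT kT @* ('ker F :&: P^`(1)).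
  have fstPH : fst_morphism hT kT @* P = H.
    apply/eqP; rewrite eqEsubset; apply/andP; split; apply/subsetP.
      by move=> _ /morphimP[w _ /P0P[Hw _ _] ->].
    move=> h Hh; have [w Pw <-] := fstP h Hh.
    by apply/morphimP; exists w; rewrite ?in_setT.
  have fstP1 : fst_morphism hT kT @* P^`(1) = H^`(1) by rewrite morphim_der ?subsetT // fstPH.
  apply/subsetP => z fz; have /setIP[_] := subsetP sZ _ fz.
  rewrite -fstP1 => /morphimP[w _ Dw zE].
  have Pw := subsetP (der_sub 1 P) _ Dw.
  apply/morphimP; exists w; rewrite ?in_setT // in_setI Dw andbT.
  by apply/kerP => //; rewrite FE; move/mker: fz; rewrite zE.
(* By the two previous facts the image has at least as many elements as the source. *)
have inj : {in 'ker F :&: P^`(1) &, injective (fst_morphism hT kT)}.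
  apply/imset_injP; rewrite eqn_leq leq_imset_card (leq_trans leFf) //.
  by apply: leq_trans (subset_leq_card fstD) _; rewrite morphimEsub ?subsetT.
pose z1 := (h1, k1); pose z2 := (h2, k2).
have [Pz1 Pz2] : z1 \in P /\ z2 \in P by split; apply/P0P.
have chE : [~ h1, h2] = 1 by apply/eqP/commgP.
have Az : [~ z1, z2] \in 'ker F :&: P^`(1).
  rewrite in_setI mem_commg // andbT; apply/kerP; rewrite ?groupR // FE.
  by rewrite -[_.1]/([~ h1, h2]) chE morph1.
have /eqP/commgP/commute_pair[_ //] : [~ z1, z2] = 1.
by apply: inj => //; rewrite -[LHS]/([~ h1, h2]) chE.
Qed.

(** * A central extension of the alternating group of degree 7 *)

Lemma checkP (s : 'S_7) :
  [/\ check_mul (code s), check_alt (code s) & check_cyclic (code s)].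
Proof.
apply/and3P; have := check_all_perms7; rewrite everyE => /allP; apply.
by rewrite /perms7 -(code1 7); apply/mem_cent/commute_sym/commute1.
Qed.

Definition permgen b : 'S_7 := decode 7 (genp b).

Lemma code_permgen b : code (permgen b) = genp b.
Proof. by apply: decodeK; case: b. Qed.

Lemma mx_one : mx one_mx = 1%:M%R.
Proof.
apply/matrixP => i j; rewrite !mxE /one_mx (nth_map 0) ?size_iota //.
by rewrite (nth_map 0) ?size_iota // !nth_iota.
Qed.

(** Both matrices have order dividing 21, so their 20th powers are their inverses. *)
Lemma genm_inv b :
  [&& wfm (genm b), wfm (iter 20 (mmul (genm b)) one_mx)
    & eqm (mmul (genm b) (iter 20 (mmul (genm b)) one_mx)) one_mx].
Proof. by case: b; vm_compute. Qed.

Lemma wfm_genm b : wfm (genm b). Proof. by case/and3P: (genm_inv b). Qed.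

Lemma mx_genm_unit b : mx (genm b) \in GRing.unit.
Proof.
case/and3P: (genm_inv b); move: (iter 20 _ _) => A gw Aw /eqmP gA1.
have gA : (mx (genm b) *m mx A = 1%:M)%R by rewrite -mx_mmul // gA1 mx_one.
exact: (proj1 (mulmx1_unit gA)).
Qed.

Definition coverT : finGroupType := ('S_7 * {'GL_6['F_7]})%type.

Definition covergen b : coverT := (permgen b, insubd (1 : {'GL_6['F_7]}) (mx (genm b))).

Lemma covergen2 b : val (covergen b).2 = mx (genm b).
Proof. by rewrite /= val_insubd mx_genm_unit. Qed.

(** The first projection maps this group onto A_7, and its kernel consists of scalar matrices. *)
Definition coverG := [group of <<[set covergen b | b in [set: bool]]>>].

Lemma mem_covergen b : covergen b \in coverG.
Proof. by rewrite mem_gen // imset_f ?inE. Qed.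

Lemma cover_ind (P : coverT -> Prop) :
  P 1 -> (forall b k, k \in coverG -> P k -> P (covergen b * k)) -> forall k, k \in coverG -> P k.
Proof.
move=> P1 PM k /gen_prodgP[n [c cg ->]] {k}.
have Pc : forall i, exists b, c i = covergen b by move=> i; have /imsetP[b _ ->] := cg i; exists b.
elim: n c cg Pc => [|n IHn] c cg Pc; first by rewrite big_ord0.
rewrite big_ord_recl; have [b ->] := Pc ord0; apply: PM; last exact: IHn.
by apply: group_prod => i _; rewrite mem_gen.
Qed.

Lemma check_mulP (s : 'S_7) : even (code s) ->
  [/\ evalw (word (code s)) = code s, wfm (liftm (code s)) &
      forall b, even (code (permgen b * s)) /\
        prop_mx (mmul (genm b) (liftm (code s))) (liftm (code (permgen b * s)))].
Proof.
move=> es; have [+ _ _] := checkP s; rewrite /check_mul es everyE.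
case/and3P=> /eqsP ws wfs /allP mul_s; split=> // b; rewrite codeM code_permgen.
by apply/andP/mul_s; case: b.
Qed.

(** Induction on a product of generators: by [check_mul], left multiplication by a generator agrees
    with the table up to a scalar. *)
Lemma cover_even k : k \in coverG -> even (code k.1) /\
  exists2 l : 'F_7, (l != 0)%R & (val k.2 = l *: mx (liftm (code k.1)))%R.
Proof.
elim/cover_ind=> [|b {}k _ [ek [l l0 kE]]].
  rewrite code1; split=> //; exists 1%R; first exact: oner_neq0.
  by rewrite (_ : liftm _ = one_mx) // mx_one scale1r.
have [_ wk /(_ b)[ebk]] := check_mulP ek; have [_ wbk _] := check_mulP ebk.
case/(prop_mxP wbk) => l' l'0 E; split=> //; exists (l * l')%R; first by rewrite mulf_neq0.
have -> : val (covergen b * k).2 = (val (covergen b).2 *m val k.2)%R by [].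
by rewrite covergen2 kE -scalemxAr -mx_mmul ?wfm_genm // E scalerA.
Qed.

Lemma evalw_cover w : exists2 k, k \in coverG & code k.1 = evalw w.
Proof.
elim: w => [|b w [k Kk kE]]; first by exists 1; rewrite ?group1 ?code1.
exists (covergen b * k); first by rewrite groupM ?mem_covergen.
by rewrite codeM code_permgen kE.
Qed.

Lemma even_cover (s : 'S_7) : even (code s) -> exists2 k, k \in coverG & k.1 = s.
Proof.
move=> es; have [ws _ _] := check_mulP es.
have [k Kk kE] := evalw_cover (word (code s)).
by exists k => //; apply: code_inj; rewrite kE.
Qed.

(** A generator has order dividing 21, so it is the square of its 11th power and therefore even. *)
Lemma permgen_Alt b : permgen b \in 'Alt_('I_7).
Proof.
have gX : permgen b ^+ 11 * permgen b ^+ 11 = permgen b.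
  have gX21 : permgen b ^+ 21 = 1.
    by apply: code_inj; do 20!rewrite expgS codeM; rewrite expg1 code_permgen code1; case: b; vm_compute.
  by rewrite -expgD (expgS _ 21) gX21 mulg1.
by rewrite Alt_even -gX odd_permM addbb.
Qed.

Lemma cover_Alt k : k \in coverG -> k.1 \in 'Alt_('I_7).
Proof.
elim/cover_ind=> [|b {}k _ Ak]; first exact: group1.
by rewrite groupM ?permgen_Alt.
Qed.

Lemma Alt_even_code (s : 'S_7) : s \in 'Alt_('I_7) -> even (code s).
Proof.
move=> As; have [_ + _] := checkP s; rewrite /check_alt => /orP[//|].
pose tau : 'S_7 := tperm (@Ordinal 7 0 isT) (@Ordinal 7 1 isT).
have <- : code tau = [:: 1%N; 0; 2; 3; 4; 5; 6].
  rewrite (@code_eq _ _ (fun i => if i == 0 then 1%N else if i == 1%N then 0 else i)) // => i.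
  by rewrite /tau; case: tpermP => [->|->|/eqP + /eqP] //; rewrite -!val_eqE /= => /negPf-> /negPf->.
rewrite -codeM => /even_cover[k /cover_Alt + kE].
by rewrite kE groupMl // Alt_even odd_tperm.
Qed.

Lemma Alt_cover (s : 'S_7) : s \in 'Alt_('I_7) -> exists2 k, k \in coverG & k.1 = s.
Proof. by move/Alt_even_code/even_cover. Qed.

(** Over the identity permutation the matrix is a scalar by [cover_even]. *)
Lemma cover_central k : k \in coverG -> k.1 = 1 -> k \in 'Z(coverG).
Proof.
move=> Kk k1; have [_ [l l0]] := cover_even Kk.
rewrite k1 code1 (_ : liftm _ = one_mx) // mx_one => kE.
rewrite inE Kk; apply/centP => -[p M] _; rewrite [k]surjective_pairing k1.
congr (_, _); first by rewrite mul1g mulg1.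
apply: val_inj; rewrite /= -[LHS]/(val k.2 *m val M)%R -[RHS]/(val M *m val k.2)%R kE.
by rewrite -scalemxAl -scalemxAr mul1mx mulmx1.
Qed.

Lemma check_cyclicP lv : even lv -> check_cyclic lv ->
  exists2 lz, lz \in lv :: [seq pcomp lv lu | lu <- cent lv & even lu] &
    forall lu, lu \in cent lv -> fixn lv <= fixn lu -> even lu ->
      lu \in powers lz \/ noncomm (liftm lv) (liftm lu).
Proof.
rewrite /check_cyclic => ->; rewrite anyE => /hasP[lz lzN].
rewrite everyE => /allP lzP; exists lz.
  move: lzN; rewrite !inE => /predU1P[->|/mapP[lu]]; first by rewrite eqxx.
  rewrite mem_filter => /andP[+ luv] ->; case: ifP => // _ elu.
  by rewrite map_f ?orbT // mem_filter elu.
move=> lu luv le_fix elu.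
have /lzP : lu \in [seq u <- cent lv | if fixn lv <= fixn u then even u else false].
  by rewrite mem_filter le_fix elu.
by rewrite anyE; case: hasP => [[x xz /eqsP->]|_]; [left | right].
Qed.

Lemma powersP (z u : 'S_7) : code u \in powers (code z) -> u \in <[z]>.
Proof.
rewrite /powers size_code -(code1 7) => /trajectP[i _ uE].
suff iterE : iter i (pcomp^~ (code z)) (code (1 : 'S_7)) = code (z ^+ i).
  by rewrite (code_inj (etrans uE iterE)) mem_cycle.
elim: i {uE} => [|i IHi]; first by rewrite expg0.
by rewrite iterS IHi expgSr codeM.
Qed.

(** Nonzero scalar factors do not affect whether matrices commute, so the tabulated matrices decide
    the matter for all elements of [coverG]. *)
Lemma cover_cyclic (v : 'S_7) : v \in 'Alt_('I_7) -> exists z : 'S_7,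
  forall kv ku, kv \in coverG -> ku \in coverG -> kv.1 = v -> commute kv ku ->
    fixn (code v) <= fixn (code ku.1) -> ku.1 \in <[z]>.
Proof.
move=> Av; have ev := Alt_even_code Av; have [_ _] := checkP v.
case/(check_cyclicP ev)=> lz lzN lzP.
have [z zE] : exists z : 'S_7, code z = lz.
  move: lzN; rewrite inE => /predU1P[->|/mapP[lu]]; first by exists v.
  rewrite mem_filter => /andP[_ /cent_code[u <-]] ->.
  by exists (v * u); rewrite codeM.
exists z => kv ku Kv Ku kvv cvu le_fix; subst v.
have [c1 c2] := (commute_pair kv ku).1 cvu.
have eu := Alt_even_code (cover_Alt Ku).
have [] := lzP (code ku.1) (mem_cent c1) le_fix eu; first by rewrite -zE; apply: powersP.
have [_ wv _] := check_mulP ev; have [_ wu _] := check_mulP eu.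
case/(noncommP wv wu).
have [_ [l l0 vE]] := cover_even Kv; have [_ [l' l'0 uE]] := cover_even Ku.
have : (val kv.2 *m val ku.2 = val ku.2 *m val kv.2)%R by exact: (congr1 val c2).
rewrite vE uE -!scalemxAl -!scalemxAr !scalerA [(l' * l)%R]mulrC.
by apply: scalerI; rewrite mulf_neq0.
Qed.

(** * Perfect deep commuting graphs *)

Section DeepAdj.
Variables (gT hT : finGroupType) (G : {set gT}) (H : {group hT}) (f : {morphism H >-> gT}).

Lemma deep_adjP x y : reflect
  (forall h1 h2, h1 \in H -> h2 \in H -> f h1 = x -> f h2 = y -> commute h1 h2)
  (deep_adj f x y).
Proof.
apply: (iffP forall_inP) => [cxy h1 h2 Hh1 Hh2 fx fy | cxy h1 Hh1].
  by apply/eqP/(implyP (forall_inP (cxy h1 Hh1) h2 Hh2)); rewrite fx fy !eqxx.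
by apply/forall_inP => h2 Hh2; apply/implyP => /andP[/eqP fx /eqP fy]; apply/eqP/cxy.
Qed.

Lemma deep_adjC x y : deep_adj f x y = deep_adj f y x.
Proof. by apply/deep_adjP/deep_adjP => cxy h1 h2 *; apply/commute_sym/cxy. Qed.

Hypothesis stem : stem_extension G f.

Lemma stem_lift x : x \in G -> exists2 h, h \in H & f h = x.
Proof. by have [<- _] := stem => /morphimP[h _ Hh ->]; exists h. Qed.

Lemma stem_central h h' : h \in H -> h' \in H -> f h = f h' ->
  exists2 a, h' = h * a & {in H, forall u, commute a u}.
Proof.
move=> Hh Hh' fhh'; exists (h^-1 * h'); first by rewrite mulKVg.
have [_ /subsetP sZ] := stem; have : h^-1 * h' \in 'ker f.
  by apply/kerP; rewrite ?groupM ?morphM ?morphV ?groupV // fhh' mulVg.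
by case/sZ/setIP=> /centerP[_ ca] _ u; apply: ca.
Qed.

(** Other lifts differ from h1 and h2 by central factors, so one commuting pair of lifts is
    enough. *)
Lemma deep_adj_lift h1 h2 : h1 \in H -> h2 \in H -> commute h1 h2 -> deep_adj f (f h1) (f h2).
Proof.
move=> Hh1 Hh2 c12; apply/deep_adjP => h1' h2' Hh1' Hh2' /esym E1 /esym E2.
have [a1 -> ca1] := stem_central Hh1 Hh1' E1; have [a2 E ca2] := stem_central Hh2 Hh2' E2.
apply: commute_sym; apply: commuteM; last by apply/commute_sym/ca1.
by rewrite E; apply/commute_sym/commuteM => //; apply/commute_sym/ca2.
Qed.

Lemma deep_adj_commute x y : x \in G -> y \in G -> deep_adj f x y -> commute x y.
Proof.
move=> /stem_lift[h1 Hh1 <-] /stem_lift[h2 Hh2 <-] /deep_adjP/(_ h1 h2 Hh1 Hh2 erefl erefl) c12.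
by rewrite /commute -!morphM // c12.
Qed.

(** Powers of c lift to powers of a single lift of c. *)
Lemma deep_adj_cycle c x y : c \in G -> x \in <[c]> -> y \in <[c]> -> deep_adj f x y.
Proof.
move=> /stem_lift[h Hh <-] /cycleP[i ->] /cycleP[j ->]; rewrite -!morphX //.
by apply: deep_adj_lift; rewrite ?groupX //; apply: commuteX2.
Qed.

End DeepAdj.

Lemma perfect_deep_adj (gT hT : finGroupType) (G : {group gT}) (H : {group hT})
    (f : {morphism H >-> gT}) (iota : {morphism G >-> 'S_7}) x :
    'injm iota -> iota @* G \subset 'Alt_('I_7) -> x \in G -> G \subset G^`(1) <*> <[x]> ->
  schur_cover G f -> perfect_graph G (deep_adj f).
Proof.
move=> inj_iota sGA Gx sG cov; have [stem _] := cov.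
pose pi := [morphism of restrm (subsetT coverG) (@fst_morphism _ _)].
have piE k : pi k = k.1 by [].
have sKZ : 'ker pi \subset 'Z(coverG).
  by apply/subsetP => k /morphpreP[Kk /set1P]; rewrite piE; apply: cover_central.
have Aiota u : u \in G -> iota u \in 'Alt_('I_7).
  by move=> Gu; apply: (subsetP sGA); rewrite mem_morphim.
have sGK : iota @* G \subset pi @* coverG.
  apply/subsetP => s /(subsetP sGA)/Alt_cover[k Kk <-].
  by rewrite -piE mem_morphim.
have commK := schur_cover_commute cov sKZ sGK Gx sG.
(* Vertices are ranked by the number of fixed points of their images. The neighbours of v of no
   smaller rank are mapped into the cyclic group of z, whose preimage in G is again cyclic, so they
   are adjacent to each other. *)
apply: (@perfect_graph_rank _ _ _ (fun u => fixn (code (iota u)))).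
  by move=> u v _ _; apply: deep_adjC.
move=> v u w Gv Gu Gw _ _ _ vu vw le_u le_w.
have [z zP] := cover_cyclic (Aiota v Gv).
have zG y : y \in G -> deep_adj f v y -> fixn (code (iota v)) <= fixn (code (iota y)) ->
    iota y \in <[z]>.
  move=> Gy vy le_y; have [hv Hv vE] := stem_lift stem Gv; have [hy Hy yE] := stem_lift stem Gy.
  have [kv Kv kvE] := Alt_cover (Aiota v Gv); have [ky Ky kyE] := Alt_cover (Aiota y Gy).
  rewrite -kyE; apply: (zP kv ky) => //; last by rewrite kyE.
  apply: (commK hv hy) => //; rewrite ?piE ?vE ?yE //.
  exact: (deep_adjP _ _ _ vy).
have cycC : cyclic (G :&: iota @*^-1 <[z]>).
  rewrite -(injm_cyclic inj_iota) ?subsetIl //.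
  by apply: cyclicS (cycle_cyclic z); rewrite sub_morphim_pre ?subsetIl ?subsetIr.
have [c cE] := cyclicP cycC.
have Gc : c \in G by have := cycle_id c; rewrite -cE => /setIP[].
by apply: (deep_adj_cycle stem Gc); rewrite -cE in_setI ?Gu ?Gw mem_morphpre ?zG.
Qed.

(** * Embeddings of permutation groups, and their derived groups *)

Lemma embed_perm m n : m <= n -> exists e : {morphism [set: 'S_m] >-> 'S_n},
  'injm e /\ forall s, odd_perm (e s) = odd_perm s.
Proof.
elim: n => [|n IHn].
  by rewrite leqn0 => /eqP->; exists [morphism of @idm _ [set: 'S_0]]; rewrite injm_idm.
rewrite leq_eqVlt => /predU1P[->|/IHn[e [inj_e odd_e]]].
  by exists [morphism of @idm _ [set: 'S_n.+1]]; rewrite injm_idm.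
have eM : {in [set: 'S_m] &, {morph (fun s => lift_perm ord_max ord_max (e s)) : s t / s * t}}.
  by move=> s t _ _ /=; rewrite lift_permM morphM ?inE.
exists (Morphism eM); split=> [|s] /=; last by rewrite odd_lift_perm addbb odd_e.
apply/injmP => s t _ _ /= est; apply: (injmP inj_e); rewrite ?inE //.
apply/permP => i; apply: (@lift_inj _ ord_max).
by rewrite -!(lift_perm_lift ord_max ord_max) est.
Qed.

(* A permutation s of n points becomes an even one of n + 2 points, by letting s exchange the
   two new points when it is odd. *)
Lemma embed_perm_Alt n : exists e : {morphism [set: 'S_n] >-> 'S_n.+2},
  'injm e /\ forall s, e s \in 'Alt_('I_n.+2).
Proof.
pose l2 (s : 'S_n) := lift_perm ord_max ord_max (lift_perm ord_max ord_max s) : 'S_n.+2.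
pose tau : 'S_n.+2 := tperm ord_max (lift ord_max ord_max).
have l2M s t : l2 (s * t) = l2 s * l2 t by rewrite /l2 !lift_permM.
have tauX s t : tau ^+ s * l2 t = l2 t * tau ^+ s.
  apply/commute_sym/commuteX/commute_sym/commgP/conjg_fixP; rewrite tpermJ /l2.
  by rewrite lift_perm_id lift_perm_lift lift_perm_id.
have tauD (b c : bool) : tau ^+ b * tau ^+ c = tau ^+ (b (+) c).
  by case: b c => -[] /=; rewrite ?mulg1 ?mul1g // expg1 tperm2.
have eM : {in [set: 'S_n] &, {morph (fun s : 'S_n => l2 s * tau ^+ s) : s t / s * t}}.
  by move=> s t _ _ /=; rewrite l2M odd_permM -tauD !mulgA -[l2 s * _ * l2 t]mulgA tauX !mulgA.
exists (Morphism eM); split=> [|s] /=; last first.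
  rewrite Alt_even odd_permM /l2 !odd_lift_perm !addbb /=.
  by case: (odd_perm s); rewrite ?odd_perm1 // expg1 odd_tperm neq_lift.
apply/injmP => s t _ _ /= est; apply/permP => i.
pose j := lift ord_max (lift ord_max i).
have eE (u : 'S_n) : (l2 u * tau ^+ u) j = lift ord_max (lift ord_max (u i)).
  rewrite permM /l2 !lift_perm_lift; case: (odd_perm u); rewrite ?perm1 // expg1 tpermD ?neq_lift //.
  by rewrite (inj_eq lift_inj) neq_lift.
by apply: (@lift_inj _ ord_max); apply: (@lift_inj _ ord_max); rewrite -!eE est.
Qed.

(** All transpositions are conjugate, so each is [tperm x y] times a commutator. *)
Lemma Sym_der_tperm (T : finType) (x y : T) : x != y ->
  [set: {perm T}] \subset [set: {perm T}]^`(1) <*> <[tperm x y]>.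
Proof.
move=> xy; apply/subsetP => s _; have [ts -> ts_d] := prod_tpermP s.
elim: ts ts_d => [|[a b] ts IHts] /=; first by rewrite big_nil group1.
case/andP=> /= ab ts_d; rewrite big_cons groupM ?{}IHts //=.
have [g <-] : exists g, tperm x y ^ g = tperm a b.
  have ya : tperm x a y != a by rewrite -[X in _ != X](tpermL x a) (inj_eq perm_inj) eq_sym.
  (* The first factor takes x to a; the second fixes a and takes the image of y to b. *)
  exists (tperm x a * tperm (tperm x a y) b).
  by rewrite tpermJ !permM (tpermL x a) (tpermL _ b) (tpermD ya) // eq_sym.
rewrite conjg_mulR; apply: groupM.
  by rewrite (subsetP (joing_subr _ _)) ?cycle_id.
by rewrite (subsetP (joing_subl _ _)) // mem_commg ?inE.
Qed.

Lemma Alt_perfect (T : finType) : 5 <= #|T| -> ('Alt_T)^`(1) = 'Alt_T.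
Proof.
move=> T5; have /simpleP[_ simA] := simple_Alt5 T5.
case: (simA _ (der_normal 1 _)) => // A1.
have := solvable_AltF T5; rewrite abelian_sol //.
exact/derG1P.
Qed.

Lemma Alt4_der : exists2 x : 'S_4, x \in 'Alt_('I_4) &
  'Alt_('I_4) \subset ('Alt_('I_4))^`(1) <*> <[x]>.
Proof.
have cyc3 l : l \in cycles3 -> exists2 a : 'S_4, code a = l & a \in 'Alt_('I_4) /\ a^-1 = a * a.
  move=> lc; have la : code (decode 4 l) = l.
    apply: decodeK; move: l lc; apply/allP; exact: isT.
  have a3 : decode 4 l * (decode 4 l * decode 4 l) = 1.
    apply: code_inj; rewrite !codeM la code1; apply/eqP.
    by move: l lc {la}; apply/allP.
  exists (decode 4 l) => //; split; last by apply/eqP; rewrite eq_invg_mul a3.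
  (* A 3-cycle is its own fourth power, hence a square and even. *)
  have lE : decode 4 l = decode 4 l * decode 4 l * (decode 4 l * decode 4 l).
    by rewrite -mulgA a3 mulg1.
  by rewrite Alt_even lE odd_permM addbb.
have [x xE [Ax _]] := cyc3 _ (mem_head _ _); exists x => //; apply/subsetP => s As.
have := check_Alt4_perms; rewrite everyE -(code1 4).
move/allP/(_ (code s) (mem_cent (commute_sym (commute1 s)))).
rewrite /check_Alt4 anyE => /hasP[_ /cyc3[a <- [Aa aV]]].
rewrite anyE => /hasP[_ /cyc3[b <- [Ab bV]]]; rewrite anyE => /hasP[k _].
have iterE i : iter i (pcomp [:: 1; 2; 0; 3]%N) (iota 0 4) = code (x ^+ i).
  by elim: i => [|i IHi]; rewrite ?expg0 ?code1 // iterS IHi expgS codeM xE.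
pose tau : 'S_4 := tperm (@Ordinal 4 0 isT) (@Ordinal 4 1 isT).
have <- : code tau = [:: 1; 0; 2; 3]%N.
  rewrite (@code_eq _ _ (fun i => if i == 0 then 1 else if i == 1 then 0 else i)%N) // => i.
  by rewrite /tau; case: tpermP => [->|->|/eqP + /eqP] //; rewrite -!val_eqE /= => /negPf-> /negPf->.
rewrite /inv3 iterE -!codeM -aV -bV.
have Dq : a^-1 * b^-1 * (a * b) * x ^+ k \in ('Alt_('I_4))^`(1) <*> <[x]>.
  apply: groupM; last by rewrite (subsetP (joing_subr _ _)) ?mem_cycle.
  rewrite (subsetP (joing_subl _ _)) // (_ : _ * _ = [~ a, b]) ?mem_commg //.
  by rewrite commgEl conjgE !mulgA.
case/orP=> /eqsP/code_inj; first by move=> ->.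
move=> sq; suff : s * tau \in 'Alt_('I_4) by rewrite groupMl // Alt_even odd_tperm.
rewrite sq; apply: (subsetP _ _ Dq); rewrite join_subG cycle_subG Ax.
by rewrite (der_sub 1 ('Alt_('I_4))%G).
Qed.

Lemma Alt_der n : 4 <= n -> exists2 x : 'S_n, x \in 'Alt_('I_n) &
  'Alt_('I_n) \subset ('Alt_('I_n))^`(1) <*> <[x]>.
Proof.
rewrite leq_eqVlt => /predU1P[<-|n5]; first exact: Alt4_der.
by exists 1; rewrite ?group1 // Alt_perfect ?card_ord // joing_subl.
Qed.

Lemma perfect_Sym n (hT : finGroupType) (H : {group hT}) (f : {morphism H >-> 'S_n}) :
  1 < n -> n <= 5 -> schur_cover [set: 'S_n] f -> perfect_graph [set: 'S_n] (deep_adj f).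
Proof.
move=> n1 n5; have [e [inj_e Ae]] := embed_perm_Alt n.
have [e' [inj_e' odd_e']] := @embed_perm n.+2 7 n5.
have iM : {in [set: 'S_n] &, {morph (fun s => e' (e s)) : s t / s * t}}.
  by move=> s t _ _; rewrite !morphM ?inE.
pose x := tperm (Ordinal (ltnW n1)) (Ordinal n1).
apply: (@perfect_deep_adj _ _ [group of [set: 'S_n]] _ _ (Morphism iM) x); rewrite ?inE //.
- apply/injmP => s t _ _ est.
  apply: (injmP inj_e s t (in_setT _) (in_setT _)).
  exact: (injmP inj_e' (e s) (e t) (in_setT _) (in_setT _) est).
- apply/subsetP => _ /morphimP[s _ _ ->].
  have -> : Morphism iM s = e' (e s) by [].
  by rewrite Alt_even odd_e' -Alt_even Ae.
exact: Sym_der_tperm.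
Qed.

Lemma perfect_Alt n (hT : finGroupType) (H : {group hT}) (f : {morphism H >-> 'S_n}) :
  4 <= n -> n <= 7 -> schur_cover 'Alt_('I_n) f -> perfect_graph 'Alt_('I_n) (deep_adj f).
Proof.
move=> n4 n7; have [e [inj_e odd_e]] := embed_perm n7; have [x Ax sA] := Alt_der n4.
apply: (@perfect_deep_adj _ _ ('Alt_('I_n))%G _ _ [morphism of restrm (subsetT 'Alt_('I_n)) e] x) => //.
  by rewrite injm_restrm.
by apply/subsetP => _ /morphimP[s _ As ->]; rewrite Alt_even /= /restrm odd_e -Alt_even.
Qed.

(** * Holes *)

Section Certificates.
Variables (gT hT : finGroupType) (G : {group gT}) (H : {group hT}) (f : {morphism H >-> gT}).
Hypothesis stem : stem_extension G f.

Lemma deep_adj_conj x y g : x \in G -> y \in G -> g \in G ->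
  deep_adj f x y -> deep_adj f (x ^ g) (y ^ g).
Proof.
move=> /(stem_lift stem)[h1 Hh1 <-] /(stem_lift stem)[h2 Hh2 <-] /(stem_lift stem)[h Hh <-].
move=> /deep_adjP/(_ h1 h2 Hh1 Hh2 erefl erefl) c12; rewrite -!morphJ //.
by apply: (deep_adj_lift stem); rewrite ?groupJ // /commute -!conjMg c12.
Qed.

(* The commutator z of two lifts is central, and conjugation by g turns it into z ^+ 2. *)
Lemma deep_adj_sqr x y g : x \in G -> y \in G -> g \in G ->
  commute x y -> x ^ g = x ^+ 2 -> y ^ g = y -> deep_adj f x y.
Proof.
move=> /(stem_lift stem)[h1 Hh1 <-] /(stem_lift stem)[h2 Hh2 <-] /(stem_lift stem)[h Hh <-].
move=> c12 E1 E2; apply: (deep_adj_lift stem) => //; apply/commgP.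
have [_ /subsetP sZ] := stem.
have zZ : [~ h1, h2] \in 'Z(H).
  suff : [~ h1, h2] \in 'ker f by move/sZ/setIP=> [].
  by apply/kerP; rewrite ?groupR // morphR //; apply/eqP/commgP.
have cz u : u \in H -> commute [~ h1, h2] u by move/centerP: zZ => [_]; apply.
have [a aE ca] : exists2 a, h1 ^ h = h1 ^+ 2 * a & {in H, forall t, commute a t}.
  by apply: (stem_central stem); rewrite ?groupX ?groupJ // morphX // -E1 morphJ.
have [b bE cb] : exists2 b, h2 ^ h = h2 * b & {in H, forall t, commute b t}.
  by apply: (stem_central stem); rewrite ?groupJ // -[LHS]E2 morphJ.
have Ha : a \in H by rewrite -(groupMl _ (groupX 2 Hh1)) -aE groupJ.
have e1 := commgC h1 h2; move: [~ h1, h2] cz e1 {zZ} => z cz e1.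
have e2 : h1 ^+ 2 * h2 = h2 * h1 ^+ 2 * z ^+ 2.
  rewrite !(expgS _ 1) !expg1 -mulgA e1 !mulgA e1.
  by rewrite -(mulgA (h2 * h1) z) (cz h1 Hh1) !mulgA.
(* Conjugation by h fixes the central z, whereas the commutator of h1 ^+ 2 and h2 is z ^+ 2;
   comparing both gives z ^+ 2 = z. *)
have : h1 ^ h * h2 ^ h = h2 ^ h * h1 ^ h * z.
  by rewrite -conjMg e1 !conjMg (_ : z ^ h = z) //; apply/conjg_fixP/commgP/cz.
have Hab : a * b \in H by rewrite groupM // -(groupMl _ Hh2) -bE groupJ.
have eR : h2 * b * (h1 ^+ 2 * a) * z = h2 * h1 ^+ 2 * z * (a * b).
  rewrite -(mulgA h2) (mulgA b) (cb _ (groupX 2 Hh1)) -(mulgA (h1 ^+ 2)) (cb a Ha).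
  by rewrite (mulgA h2) -(mulgA _ (a * b)) -(cz _ Hab) !mulgA.
rewrite aE bE -mulgA (mulgA a) (ca h2 Hh2) -(mulgA h2 a) (mulgA (h1 ^+ 2)) e2 eR.
move/mulIg/mulgI; rewrite expgS expg1 => zz.
by apply/eqP/(mulgI z); rewrite zz mulg1.
Qed.

(** Both elements are powers of x * y. *)
Lemma deep_adj_coprime x y : x \in G -> y \in G -> commute x y -> coprime #[x] #[y] -> deep_adj f x y.
Proof.
move=> Gx Gy cxy co; have cycE := cycleM cxy co; apply: (deep_adj_cycle stem (groupM Gx Gy)).
  by rewrite cycE; apply: (subsetP (mulG_subl _ _)); rewrite cycle_id.
by rewrite cycE; apply: (subsetP (mulG_subr _ _)); rewrite cycle_id.
Qed.

End Certificates.

(** Points outside c are fixed, since [next] returns them unchanged. *)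
Definition cycle_code m (c : seq nat) := [seq next c i | i <- iota 0 m].
Definition cycle_perm m (c : seq nat) : 'S_m := decode m (cycle_code m c).

Lemma code_cycle_perm m c : perm_eq (cycle_code m c) (iota 0 m) ->
  code (cycle_perm m c) = cycle_code m c.
Proof. exact: decodeK. Qed.

Definition valid_cycles m (L : seq (seq nat)) :=
  all (fun c => perm_eq (cycle_code m c) (iota 0 m)) L && uniq [seq cycle_code m c | c <- L].

Definition commuting_codes m c c' :=
  pcomp (cycle_code m c) (cycle_code m c') == pcomp (cycle_code m c') (cycle_code m c).

Lemma commuteE m c c' :
    perm_eq (cycle_code m c) (iota 0 m) -> perm_eq (cycle_code m c') (iota 0 m) ->
  reflect (commute (cycle_perm m c) (cycle_perm m c')) (commuting_codes m c c').
Proof.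
move=> vc vc'; rewrite /commuting_codes -(code_cycle_perm vc) -(code_cycle_perm vc') -!codeM.
by apply: (iffP eqP) => [/code_inj | ->].
Qed.

Section Holes.
Variables (m n : nat) (G : {group 'S_n}) (hT : finGroupType) (H : {group hT}).
Variables (f : {morphism H >-> 'S_n}) (e : {morphism [set: 'S_m] >-> 'S_n}).
Hypotheses (stem : stem_extension G f) (inj_e : 'injm e).

Lemma embedM s t : e (s * t) = e s * e t.
Proof. by rewrite morphM ?in_setT. Qed.

Lemma embed_inj : injective e.
Proof. by move=> s t est; apply: (injmP inj_e); rewrite ?in_setT. Qed.

Lemma embed_commute s t : commute (e s) (e t) <-> commute s t.
Proof. by rewrite /commute -!embedM; split=> [/embed_inj | ->]. Qed.

Lemma embedJ s t : e (s ^ t) = e s ^ e t.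
Proof. by rewrite morphJ ?in_setT. Qed.

Lemma hole_not_perfect (L : seq (seq nat)) :
    odd (size L) -> 3 < size L -> valid_cycles m L ->
    (forall c, c \in L -> e (cycle_perm m c) \in G) ->
    (forall i, i < size L ->
       deep_adj f (e (cycle_perm m (nth [::] L i)))
                  (e (cycle_perm m (nth [::] L (i.+1 %% size L))))) ->
    (forall i j, i < size L -> j < size L -> i < j -> ~~ cyclic_succ (size L) i j ->
       ~~ deep_adj f (e (cycle_perm m (nth [::] L i))) (e (cycle_perm m (nth [::] L j)))) ->
  ~ perfect_graph G (deep_adj f).
Proof.
move=> oddL L3 /andP[/allP vL uL] LG edge nonedge.
pose x i := e (cycle_perm m (nth [::] L i)).
apply: (@odd_hole_not_perfect _ _ _ (size L) x) => //.
- move=> i j ltiL ltjL /embed_inj xij.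
  have /eqP := congr1 (@code m) xij; rewrite !code_cycle_perm ?vL ?mem_nth //.
  rewrite -![cycle_code m _](nth_map [::] [::] (cycle_code m)) //.
  by rewrite nth_uniq ?size_map // => /eqP.
- by move=> i ltiL; rewrite LG ?mem_nth.
have sym : forall i j, cyclic_succ (size L) i j = cyclic_succ (size L) j i.
  by move=> i j; rewrite /cyclic_succ; lia.
have fwd i j : i < size L -> j < size L -> i < j -> deep_adj f (x i) (x j) = cyclic_succ (size L) i j.
  move=> ltiL ltjL ltij; apply/idP/idP; first by apply: contraLR; apply: nonedge.
  rewrite /cyclic_succ => /or3P[/eqP jE | /eqP iE | ].
  - by have := edge i ltiL; rewrite -jE modn_small.
  - by rewrite iE ltnNge leqnSn in ltij.
  case/orP=> /andP[/eqP E1 /eqP E2]; last by rewrite E1 in ltij.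
  have jS : j.+1 = size L by move: E2 L3; lia.
  by have := edge j ltjL; rewrite jS modnn deep_adjC E1.
move=> i j ltiL ltjL; rewrite neq_ltn => /orP[ltij|ltji]; first exact: fwd.
by rewrite deep_adjC sym fwd.
Qed.

Lemma noncommuting_deep_adj c c' :
    perm_eq (cycle_code m c) (iota 0 m) -> perm_eq (cycle_code m c') (iota 0 m) ->
    e (cycle_perm m c) \in G -> e (cycle_perm m c') \in G ->
  ~~ commuting_codes m c c' -> ~~ deep_adj f (e (cycle_perm m c)) (e (cycle_perm m c')).
Proof.
move=> vc vc' Gc Gc'; apply: contraNN => /(deep_adj_commute stem Gc Gc')/embed_commute cc.
exact/commuteE.
Qed.

Definition valid_cycle c := perm_eq (cycle_code m c) (iota 0 m).

Definition check_coprime c c' :=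
  [&& valid_cycle c, valid_cycle c', commuting_codes m c c',
      pcomp (cycle_code m c) (cycle_code m c) == iota 0 m
    & pcomp (cycle_code m c') (pcomp (cycle_code m c') (cycle_code m c')) == iota 0 m].

Lemma coprime_deep_adj c c' :
    e (cycle_perm m c) \in G -> e (cycle_perm m c') \in G -> check_coprime c c' ->
  deep_adj f (e (cycle_perm m c)) (e (cycle_perm m c')).
Proof.
move=> Gc Gc' /and5P[vc vc' /(commuteE vc vc')/embed_commute cc].
rewrite -(code_cycle_perm vc) -(code_cycle_perm vc') -!codeM -code1.
move=> /eqP/code_inj c2 /eqP/code_inj c3.
apply: (deep_adj_coprime stem) => //.
have d2 : #[e (cycle_perm m c)] %| 2.
  by rewrite order_dvdn expgS expg1 -embedM c2 morph1.
have d3 : #[e (cycle_perm m c')] %| 3.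
  by rewrite order_dvdn !expgS expg0 mulg1 -!embedM c3 morph1.
by apply: coprime_dvdl d2 _; apply: coprime_dvdr d3 _.
Qed.

(** Here l lists the values of the conjugating element g of [deep_adj_sqr]; the conjugation
    identities are multiplied out to avoid inverses. *)
Definition check_sqr c c' l :=
  [&& valid_cycle c, valid_cycle c', perm_eq l (iota 0 m) && commuting_codes m c c',
      pcomp (cycle_code m c') l == pcomp l (cycle_code m c')
    & pcomp (cycle_code m c) l == pcomp l (pcomp (cycle_code m c) (cycle_code m c))].

Lemma sqr_deep_adj c c' l :
    e (cycle_perm m c) \in G -> e (cycle_perm m c') \in G -> e (decode m l) \in G ->
    check_sqr c c' l ->
  deep_adj f (e (cycle_perm m c)) (e (cycle_perm m c')).
Proof.
move=> Gc Gc' + /and5P[vc vc' /andP[vl /(commuteE vc vc')/embed_commute cc]].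
move: (decode m l) (decodeK vl) => g <- Gg {vl l}.
rewrite -(code_cycle_perm vc) -(code_cycle_perm vc') -!codeM.
move=> /eqP/code_inj cg /eqP/code_inj cE.
apply: (@deep_adj_sqr _ _ _ _ _ stem _ _ (e g)) => //.
  by rewrite -embedJ conjgE cE mulKg embedM expgS expg1.
by apply/conjg_fixP/commgP/embed_commute.
Qed.

Definition check_conj a b c d l :=
  [&& all valid_cycle [:: a; b; c; d], perm_eq l (iota 0 m),
      pcomp (cycle_code m a) l == pcomp l (cycle_code m c)
    & pcomp (cycle_code m b) l == pcomp l (cycle_code m d)].

Lemma conj_deep_adj a b c d l :
    e (cycle_perm m a) \in G -> e (cycle_perm m b) \in G -> e (decode m l) \in G ->
    check_conj a b c d l ->
  deep_adj f (e (cycle_perm m a)) (e (cycle_perm m b)) ->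
  deep_adj f (e (cycle_perm m c)) (e (cycle_perm m d)).
Proof.
move=> Ga Gb + /and4P[/and5P[va vb vc vd _] vl].
move: (decode m l) (decodeK vl) => g <- Gl {vl l}.
rewrite -(code_cycle_perm va) -(code_cycle_perm vb) -(code_cycle_perm vc).
rewrite -(code_cycle_perm vd) -!codeM => /eqP/code_inj ac /eqP/code_inj bd.
move/(deep_adj_conj stem Ga Gb Gl).
by rewrite -!embedJ !conjgE ac bd !mulKg.
Qed.

(** The pairs in [ex] are those whose nonadjacency is to be shown by other means than
    noncommutation. *)
Definition check_nonedges (L : seq (seq nat)) (ex : seq (nat * nat)) :=
  all (fun i => all (fun j => [|| j <= i, cyclic_succ (size L) i j, (i, j) \in ex
     | ~~ commuting_codes m (nth [::] L i) (nth [::] L j)]) (iota 0 (size L))) (iota 0 (size L)).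

Lemma check_nonedgesP L ex : valid_cycles m L -> check_nonedges L ex ->
    (forall c, c \in L -> e (cycle_perm m c) \in G) ->
    (forall i j, (i, j) \in ex -> ~~ deep_adj f (e (cycle_perm m (nth [::] L i))) (e (cycle_perm m (nth [::] L j)))) ->
  forall i j, i < size L -> j < size L -> i < j -> ~~ cyclic_succ (size L) i j ->
    ~~ deep_adj f (e (cycle_perm m (nth [::] L i))) (e (cycle_perm m (nth [::] L j))).
Proof.
move=> /andP[/allP vL _] chk LG exP i j ltiL ltjL ltij nij.
have /allP/(_ j) : all (fun j => [|| j <= i, cyclic_succ (size L) i j, (i, j) \in ex
     | ~~ commuting_codes m (nth [::] L i) (nth [::] L j)]) (iota 0 (size L)).
  by apply: (allP chk); rewrite mem_iota.
rewrite mem_iota ltjL (leqNgt j) ltij (negPf nij) /= => /(_ isT)/orP[|]; first exact: exP.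
by apply: noncommuting_deep_adj; rewrite ?vL ?LG ?mem_nth.
Qed.

End Holes.

Lemma not_perfect_Sym n (hT : finGroupType) (H : {group hT}) (f : {morphism H >-> 'S_n}) :
  6 <= n -> stem_extension [set: 'S_n] f -> ~ perfect_graph [set: 'S_n] (deep_adj f).
Proof.
move=> n6 stem; have [e [inj_e _]] := embed_perm n6.
pose x c := e (cycle_perm 6 c).
have xG s : e s \in [set: 'S_n]%G by rewrite in_setT.
have [adj|nadj] := boolP (deep_adj f (x [:: 0; 1]%N) (x [:: 2; 3]%N)).
  (* A 5-cycle in the Petersen graph of disjoint transpositions of 0, ..., 4. Every edge is
     conjugate to the assumed one, and nonadjacent transpositions share a point. *)
  pose L := [:: [:: 0; 1]; [:: 2; 3]; [:: 0; 4]; [:: 1; 2]; [:: 3; 4]]%N.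
  have vL : valid_cycles 6 L by vm_compute.
  apply: (@hole_not_perfect 6 n [set: 'S_n]%G _ _ _ e inj_e L isT isT vL) => [c _ | |]; first exact: xG.
    have edge c d l : check_conj 6 [:: 0; 1]%N [:: 2; 3]%N c d l -> deep_adj f (x c) (x d).
      by move=> chk; apply: (conj_deep_adj stem (xG _) (xG _) (xG _) chk).
    case=> [|[|[|[|[|i]]]]] i5; last by case: (notF i5).
    - exact: adj.
    - exact: (edge _ _ [:: 2; 3; 0; 4; 1; 5]%N).
    - exact: (edge _ _ [:: 0; 4; 1; 2; 3; 5]%N).
    - exact: (edge _ _ [:: 1; 2; 3; 4; 0; 5]%N).
    exact: (edge _ _ [:: 3; 4; 0; 1; 2; 5]%N).
  by apply: (check_nonedgesP stem inj_e (ex := [::]) vL isT).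
(* Edges join disjoint cycles of coprime orders 2 and 3, except the second: there (2 3) inverts one
   3-cycle and centralises the other. The only nonadjacent pair that commutes is (0 1), (2 3), where
   the case assumption applies. *)
pose L := [:: [:: 0; 1]; [:: 2; 3; 4]; [:: 0; 1; 5]; [:: 2; 3]; [:: 0; 4; 5]; [:: 1; 2]; [:: 3; 4; 5]]%N.
have vL : valid_cycles 6 L by vm_compute.
apply: (@hole_not_perfect 6 n [set: 'S_n]%G _ _ _ e inj_e L isT isT vL) => [c _ | |]; first exact: xG.
  have edge c d : check_coprime 6 c d -> deep_adj f (x c) (x d).
    by move=> chk; apply: (coprime_deep_adj stem inj_e (xG _) (xG _) chk).
  case=> [|[|[|[|[|[|[|i]]]]]]] i7; last by case: (notF i7).
  - exact: edge.
  - exact: (sqr_deep_adj stem inj_e (l := [:: 0; 1; 3; 2; 4; 5]%N) (xG _) (xG _) (xG _)).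
  - by rewrite deep_adjC; apply: edge.
  - exact: edge.
  - by rewrite deep_adjC; apply: edge.
  - exact: edge.
  by rewrite deep_adjC; apply: edge.
apply: (check_nonedgesP stem inj_e (ex := [:: (0, 3)]%N) vL isT) => [c _ | i j]; first exact: xG.
by rewrite inE => /eqP[-> ->].
Qed.

Lemma not_perfect_Alt n (hT : finGroupType) (H : {group hT}) (f : {morphism H >-> 'S_n}) :
  8 <= n -> stem_extension 'Alt_('I_n) f -> ~ perfect_graph 'Alt_('I_n) (deep_adj f).
Proof.
move=> n8 stem; have [e [inj_e odd_e]] := embed_perm n8.
have sqrG (s : 'S_8) : e (s * s) \in ('Alt_('I_n))%G.
  by rewrite Alt_even odd_e odd_permM addbb.
pose L := [:: [:: 0; 1; 2]; [:: 3; 4; 5]; [:: 0; 6; 7]; [:: 1; 2; 3]; [:: 4; 5; 6]]%N.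
have vL : valid_cycles 8 L by vm_compute.
have LG c : c \in L -> e (cycle_perm 8 c) \in ('Alt_('I_n))%G.
  move=> cL; have vc : perm_eq (cycle_code 8 c) (iota 0 8) by have /andP[/allP->] := vL.
  suff -> : cycle_perm 8 c = (cycle_perm 8 c * cycle_perm 8 c) * (cycle_perm 8 c * cycle_perm 8 c).
    exact: sqrG.
  apply: code_inj; rewrite !codeM code_cycle_perm //; apply/eqP.
  by move: c cL {vc}; apply/allP; vm_compute.
apply: (@hole_not_perfect 8 n ('Alt_('I_n))%G _ _ _ e inj_e L isT isT vL LG).
  (* The conjugating permutation is the square of a 4-cycle h, hence even: a double transposition
     that inverts c and moves no point of d. *)
  have edge h c d : c \in L -> d \in L -> perm_eq (cycle_code 8 h) (iota 0 8) ->
      check_sqr 8 c d (pcomp (cycle_code 8 h) (cycle_code 8 h)) ->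
    deep_adj f (e (cycle_perm 8 c)) (e (cycle_perm 8 d)).
    move=> cL dL vh chk; apply: (sqr_deep_adj stem inj_e _ _ _ chk); rewrite ?LG //.
    suff -> : decode 8 (pcomp (cycle_code 8 h) (cycle_code 8 h)) = cycle_perm 8 h * cycle_perm 8 h.
      exact: sqrG.
    apply: code_inj; rewrite codeM code_cycle_perm // decodeK //.
    by case/and5P: chk => _ _ /andP[].
  case=> [|[|[|[|[|i]]]]] i5; last by case: (notF i5).
  - exact: (edge [:: 0; 6; 1; 7]%N).
  - exact: (edge [:: 3; 1; 4; 2]%N).
  - exact: (edge [:: 0; 4; 6; 5]%N).
  - exact: (edge [:: 1; 0; 2; 7]%N).
  exact: (edge [:: 4; 3; 5; 7]%N).
by apply: (check_nonedgesP stem inj_e (ex := [::]) vL isT).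
Qed.


Theorem theorem5p23 (n : nat) (hn : 4 <= n) :
  (forall (hT : finGroupType) (H : {group hT}) (f : {morphism H >-> 'S_n}),
     schur_cover [set: 'S_n] f ->
     (perfect_graph [set: 'S_n] (deep_adj f) <-> n <= 5)) /\
  (forall (hT : finGroupType) (H : {group hT}) (f : {morphism H >-> 'S_n}),
     schur_cover (Alt 'I_n) f ->
     (perfect_graph (Alt 'I_n) (deep_adj f) <-> n <= 7)).
Proof.
split=> hT H f cov; have [stem _] := cov; split=> [perf | len].
- by rewrite leqNgt; apply/negP => n6; apply: (not_perfect_Sym n6 stem perf).
- by apply: perfect_Sym => //; apply: leq_trans hn.
- by rewrite leqNgt; apply/negP => n8; apply: (not_perfect_Alt n8 stem perf).
exact: perfect_Alt.
Qed.
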